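(* Let $\Lambda_0$ be a (finite or countable) biconnected graph. Let $H\le\mathrm{Aut}(\Lambda_0)$, let $\{Q_j : j\in\mathbb{J}\}$ be the set of orbits of $H$ on $V\Lambda_0$, and let $\{R_k : k\in\mathbb{K}\}$ be a partition of $V\Lambda_0$ such that each $Q_j$ is contained in some $R_k$. For each $k\in\mathbb{K}$ let $\mu_k:\mathbb{J}\to\mathbb{N}\cup\{0,\aleph_0\}$ be a function with $\mu_k(j)>0$ if and only if $Q_j\subseteq R_k$, and suppose $\sum_{j\in\mathbb{J}}\mu_k(j)\ge 2$ for at least one $k\in\mathbb{K}$. Then there exists, unique up to isomorphism, a lobe-transitive graph $\Gamma$ of connectivity $1$ together with isomorphisms $\sigma_\Lambda:\Lambda_0\to\Lambda$ for every lobe $\Lambda\in\mathscr{L}(\Gamma)$ such that for each vertex $v\in V\Gamma$ there is $k\in\mathbb{K}$ with $$\mu_k(j)=\bigl|\{\Lambda\in\mathscr{L}(\Gamma): \sigma_\Lambda^{-1}(v)\in Q_j\}\bigr|\quad\text{for all } j\in\mathbb{J}.$$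
   Context: All graphs are simple, connected, and finite or countably infinite. For edges $e_1,e_2$ of a graph $\Gamma$ write $e_1\cong e_2$ if $e_1=e_2$ or they lie on a common cycle; a lobe of $\Gamma$ is the subgraph induced by an equivalence class of this relation (a cut-edge with its ends, or a maximal biconnected subgraph). $\mathscr{L}(\Gamma)$ is the set of lobes. A connected graph other than $K_2$ has connectivity $1$ iff some vertex lies in at least two lobes. $\Gamma$ is lobe-transitive if $\mathrm{Aut}(\Gamma)$ acts transitively on $\mathscr{L}(\Gamma)$. $\mathbb{N}$ denotes the positive integers. *)

(* Defs.v *)
From Stdlib Require Import List Arith Lia.
Import ListNotations.
Set Implicit Arguments.

Definition countable_vtx (V : Type) : Prop :=
  exists f : V -> nat, forall x y, f x = f y -> x = y.

Inductive reach {V : Type} (adj : V -> V -> Prop) : V -> V -> Prop :=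
| reach_refl x : reach adj x x
| reach_step x y z : adj x y -> reach adj y z -> reach adj x z.

Section Graphs.
Context {V : Type} (adj : V -> V -> Prop).

Definition simple_graph : Prop :=
  (forall x y, adj x y -> adj y x) /\ (forall x, ~ adj x x).



Definition connected : Prop := (exists x : V, True) /\ forall x y, reach adj x y.

Definition adj_minus (w : V) (x y : V) : Prop := x <> w /\ y <> w /\ adj x y.

Definition biconnected : Prop :=
  connected /\
  (exists a b c : V, a <> b /\ b <> c /\ a <> c) /\
  forall w x y, x <> w -> y <> w -> reach (adj_minus w) x y.

Definition connectivity1 : Prop :=
  connected /\
  exists w x y, x <> w /\ y <> w /\ ~ reach (adj_minus w) x y.

Definition same_edge (e1 e2 : V * V) : Prop :=
  (fst e1 = fst e2 /\ snd e1 = snd e2) \/ (fst e1 = snd e2 /\ snd e1 = fst e2).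

Definition is_cycle (c : list V) : Prop :=
  3 <= length c /\ NoDup c /\
  forall i x y, nth_error c i = Some x ->
    nth_error c (S i mod length c) = Some y -> adj x y.

Definition on_cycle (e : V * V) (c : list V) : Prop :=
  exists i, (nth_error c i = Some (fst e) /\ nth_error c (S i mod length c) = Some (snd e))
         \/ (nth_error c i = Some (snd e) /\ nth_error c (S i mod length c) = Some (fst e)).

Definition edge_equiv (e1 e2 : V * V) : Prop :=
  same_edge e1 e2 \/ exists c, is_cycle c /\ on_cycle e1 c /\ on_cycle e2 c.

(* a lobe, represented by its edge set (an equivalence class of ≅) *)
Definition is_lobe (L : V * V -> Prop) : Prop :=
  exists x y, adj x y /\
    forall e, L e <-> (adj (fst e) (snd e) /\ edge_equiv (x, y) e).

Definition lobe_vtx (L : V * V -> Prop) (v : V) : Prop := exists w, L (v, w).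

Definition is_aut (f : V -> V) : Prop :=
  (forall x y, f x = f y -> x = y) /\ (forall y, exists x, f x = y) /\
  (forall x y, adj x y <-> adj (f x) (f y)).

Definition lobe_transitive : Prop :=
  forall L1 L2, is_lobe L1 -> is_lobe L2 ->
    exists f, is_aut f /\ forall e, L1 e <-> L2 (f (fst e), f (snd e)).

End Graphs.

Definition lobe_iso {V0 V : Type} (adj0 : V0 -> V0 -> Prop)
  (L : V * V -> Prop) (s : V0 -> V) : Prop :=
  (forall a, lobe_vtx L (s a)) /\ (forall a b, s a = s b -> a = b) /\
  (forall v, lobe_vtx L v -> exists a, s a = v) /\
  (forall a b, adj0 a b <-> L (s a, s b)).

Definition graph_iso {V1 V2 : Type} (adj1 : V1 -> V1 -> Prop)
  (adj2 : V2 -> V2 -> Prop) : Prop :=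
  exists f : V1 -> V2, (forall x y, f x = f y -> x = y) /\
    (forall y, exists x, f x = y) /\ (forall x y, adj1 x y <-> adj2 (f x) (f y)).

(* cardinals in N ∪ {0, aleph_0}: Some n = n, None = aleph_0 *)
Definition has_card {T : Type} (A : T -> Prop) (c : option nat) : Prop :=
  match c with
  | Some n => exists l, NoDup l /\ length l = n /\ forall x, A x <-> In x l
  | None => ~ exists l, forall x, A x -> In x l
  end.

Definition cval (c : option nat) : nat := match c with Some n => n | None => 0 end.

(* \sum_j mu j >= 2 (cardinal sum = sup of finite partial sums) *)
Definition card_sum_ge2 {J : Type} (mu : J -> option nat) : Prop :=
  (exists j, mu j = None) \/
  exists l : list J, NoDup l /\ 2 <= fold_right (fun j s => cval (mu j) + s) 0 l.

Definition aut_subgroup {V0 : Type} (adj0 : V0 -> V0 -> Prop)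
  (H : (V0 -> V0) -> Prop) : Prop :=
  (forall h, H h -> is_aut adj0 h) /\ H (fun x => x) /\
  (forall g h, H g -> H h -> H (fun x => g (h x))) /\
  (forall h, H h -> exists g, H g /\ (forall x, g (h x) = x) /\ (forall x, h (g x) = x)).

Definition orbits_indexed {V0 J : Type} (H : (V0 -> V0) -> Prop)
  (Q : J -> V0 -> Prop) : Prop :=
  (forall j, exists v, forall w, Q j w <-> exists h, H h /\ h v = w) /\
  (forall v, exists j, Q j v) /\
  (forall j j', (forall w, Q j w <-> Q j' w) -> j = j').

Definition partition_indexed {V0 K : Type} (R : K -> V0 -> Prop) : Prop :=
  (forall k, exists v, R k v) /\ (forall v, exists k, R k v) /\
  (forall k k' v, R k v -> R k' v -> k = k').

Definition realizes {V0 J K : Type} (adj0 : V0 -> V0 -> Prop)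
  (Q : J -> V0 -> Prop) (mu : K -> J -> option nat)
  {V : Type} (adj : V -> V -> Prop) : Prop :=
  simple_graph adj /\ countable_vtx V /\ connectivity1 adj /\ lobe_transitive adj /\
  exists sigma : (V * V -> Prop) -> V0 -> V,
    (forall L, is_lobe adj L -> lobe_iso adj0 L (sigma L)) /\
    forall v : V, exists k : K, forall j : J,
      has_card (fun L => is_lobe adj L /\ exists a, Q j a /\ sigma L a = v) (mu k j).

(* Main.v *)
(** In any realization a vertex separates the lobes through it: were two edges at [v], in
    different lobes, joined off [v], an ear argument would put them on a common cycle, and
    biconnectedness of [V0] would then merge the two lobes. Hence the lobes are arranged like
    a tree, and choosing a starting lobe, an enumeration of the lobes of each type at each
    vertex, and elements of [H] that turn each new copy of [V0] into place, one unfolds the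
    realization along words that record the successive branchings. This identifies it with
    one explicit graph on such words, the starting lobe becoming the copy at the empty word.
    Uniqueness follows; applied to the explicit graph itself with two different starting
    lobes, the same identification gives lobe-transitivity. *)

Require Import Defs.
From Stdlib Require Import List Permutation Arith Lia Classical ClassicalEpsilon.
From Stdlib Require Import FunctionalExtensionality PropExtensionality.
From Stdlib Require Import ProofIrrelevance IndefiniteDescription Cantor.
Import ListNotations.

(** * Walks and cycles *)

(** Two obstacles shape the proof. [edge_equiv] is defined by single cycles and is not transitive on
    its face; the classes behind [is_lobe] are therefore controlled by two facts: an equivalence can
    be pivoted around a vertex, and the image of a biconnected graph stays in one class. Secondly,
    the maps [sigma] of a realization are unrelated to one another, so a lobe may meet a vertex at
    any member of the prescribed orbit. A letter of a word hence stores only an orbit and a number,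
    the new copy is glued at the fixed representative [rep j], and [H] absorbs the difference. The
    index [k] of a vertex can be read off from one lobe through it, because [mu k (typ a)] is
    nonzero only for the block of [a]; so the same counts govern every realization. At each vertex
    the copy one comes from is number 0 within its own orbit, which lets [mu] bound the numbers as
    it stands, infinite values included, with no subtraction of one. Gluing is done by normal forms
    and not by a quotient: a vertex is addressed in the copy nearest to the base that contains
    it. *)

Lemma reach_one {V} (adj : V -> V -> Prop) x y : adj x y -> reach adj x y.
Proof. intros h; apply reach_step with y; [exact h | apply reach_refl]. Qed.

Lemma reach_trans {V} (adj : V -> V -> Prop) x y z :
  reach adj x y -> reach adj y z -> reach adj x z.
Proof.
  induction 1 as [x | x x' y h _ IH]; intros hz; [exact hz |].
  apply reach_step with x'; auto.
Qed.

Lemma reach_sym {V} (adj : V -> V -> Prop) x y :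
  (forall a b, adj a b -> adj b a) -> reach adj x y -> reach adj y x.
Proof.
  intros hs; induction 1 as [x | x x' y h _ IH]; [apply reach_refl |].
  apply reach_trans with x'; [exact IH | apply reach_one; auto].
Qed.

Lemma reach_map {V W} (adj : V -> V -> Prop) (adj' : W -> W -> Prop) (s : V -> W) x y :
  (forall a b, adj a b -> adj' (s a) (s b)) -> reach adj x y -> reach adj' (s x) (s y).
Proof.
  intros hs; induction 1 as [x | x x' y h _ IH]; [apply reach_refl |].
  apply reach_step with (s x'); auto.
Qed.

Lemma reach_closed {V} (adj : V -> V -> Prop) (P : V -> Prop) x y :
  (forall a b, P a -> adj a b -> P b) -> P x -> reach adj x y -> P y.
Proof. intros hc hx hr; revert hx; induction hr; eauto. Qed.

Lemma adj_minus_sym {V} (adj : V -> V -> Prop) w x y :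
  (forall a b, adj a b -> adj b a) -> adj_minus adj w x y -> adj_minus adj w y x.
Proof. intros hs (h1 & h2 & h3); repeat split; auto. Qed.

Lemma reach_minus_sym {V} (adj : V -> V -> Prop) w x y :
  (forall a b, adj a b -> adj b a) ->
  reach (adj_minus adj w) x y -> reach (adj_minus adj w) y x.
Proof. intros hs; apply reach_sym; intros a b; apply adj_minus_sym, hs. Qed.

(** Cycles are handled as closed lists [x :: p ++ [x]] with their consecutive pairs; unlike indices
    modulo the length, these behave well under cutting, reversing and gluing. *)
Fixpoint consec {T} (l : list T) (a b : T) : Prop :=
  match l with
  | x :: t => match t with y :: _ => (x = a /\ y = b) \/ consec t a b | [] => False end
  | [] => False
  end.

Lemma consec_cons2 {T} (x y : T) l a b :
  consec (x :: y :: l) a b <-> (x = a /\ y = b) \/ consec (y :: l) a b.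
Proof. reflexivity. Qed.

Lemma consec_app {T} (l1 l2 : list T) y a b :
  consec (l1 ++ y :: l2) a b <-> consec (l1 ++ [y]) a b \/ consec (y :: l2) a b.
Proof.
  induction l1 as [| x [| x' l1] IH].
  - simpl; tauto.
  - simpl; tauto.
  - change ((x :: x' :: l1) ++ y :: l2) with (x :: x' :: (l1 ++ y :: l2)).
    change ((x :: x' :: l1) ++ [y]) with (x :: x' :: (l1 ++ [y])).
    rewrite !consec_cons2; simpl app in IH; rewrite IH; tauto.
Qed.

Lemma consec_cons {T} (l : list T) x a b : consec l a b -> consec (x :: l) a b.
Proof. destruct l; simpl; tauto. Qed.

Lemma consec_appl {T} (l l' : list T) a b : consec l a b -> consec (l ++ l') a b.
Proof.
  induction l as [| x [| y l] IH]; [simpl; tauto | simpl; tauto |].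
  change ((x :: y :: l) ++ l') with (x :: y :: (l ++ l')).
  rewrite !consec_cons2; intros [h | h]; [left; exact h | right; apply IH, h].
Qed.

Lemma consec_rev {T} (l : list T) a b : consec (rev l) a b -> consec l b a.
Proof.
  induction l as [| x [| y l] IH]; [simpl; tauto | simpl; tauto |].
  change (rev (x :: y :: l)) with ((rev l ++ [y]) ++ [x]).
  rewrite <- app_assoc; change ([y] ++ [x]) with (y :: [x]).
  rewrite consec_app, consec_cons2; intros [h | h].
  - right; apply IH, h.
  - simpl in h; left; tauto.
Qed.

Lemma consec_nth {T} (l : list T) a b :
  consec l a b <-> exists i, nth_error l i = Some a /\ nth_error l (S i) = Some b.
Proof.
  induction l as [| x [| y l] IH].
  - split; [intros [] | intros [[| i] [h _]]; discriminate].
  - split; [intros [] | intros [i [_ h]]; destruct i; discriminate].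
  - rewrite consec_cons2, IH; split.
    + intros [[-> ->] | (i & h1 & h2)]; [exists 0; auto | exists (S i); auto].
    + intros ([| i] & h1 & h2); simpl in h1, h2.
      * left; split; congruence.
      * right; exists i; auto.
Qed.

Lemma cyclic_next {T} (x : T) p a b :
  (exists i, nth_error (x :: p) i = Some a /\
     nth_error (x :: p) (S i mod length (x :: p)) = Some b)
  <-> consec (x :: p ++ [x]) a b.
Proof.
  rewrite consec_nth; change (x :: p ++ [x]) with ((x :: p) ++ [x]).
  set (c := x :: p); set (n := length c).
  assert (hn : n <> 0) by (unfold n, c; simpl; lia).
  assert (key : forall i, i < n ->
    nth_error c (S i mod n) = nth_error (c ++ [x]) (S i)).
  { intros i hi; destruct (Nat.eq_dec (S i) n) as [e | ne].
    - rewrite e, Nat.Div0.mod_same, nth_error_app2 by (unfold n; lia).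
      unfold n; rewrite Nat.sub_diag; reflexivity.
    - rewrite Nat.mod_small, nth_error_app1 by (unfold n in *; lia); reflexivity. }
  split; intros (i & h1 & h2); exists i.
  - assert (hi : i < n) by (apply nth_error_Some; congruence).
    rewrite nth_error_app1, <- key by exact hi; auto.
  - assert (hi : S i < length (c ++ [x])) by (apply nth_error_Some; congruence).
    assert (hi' : i < n) by (rewrite length_app, Nat.add_1_r in hi; fold n in hi; lia).
    rewrite nth_error_app1 in h1 by exact hi'; rewrite key by exact hi'; auto.
Qed.

Lemma is_cycle_cons {V} (adj : V -> V -> Prop) x p :
  is_cycle adj (x :: p) <->
  2 <= length p /\ NoDup (x :: p) /\ forall a b, consec (x :: p ++ [x]) a b -> adj a b.
Proof.
  unfold is_cycle; split; intros (h1 & h2 & h3);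
    (split; [simpl in *; lia | split; [exact h2 |]]).
  - intros a b; rewrite <- cyclic_next; intros (i & ha & hb); eauto.
  - intros i a b ha hb; apply h3, cyclic_next; eauto.
Qed.

Lemma on_cycle_cons {V} (a b x : V) p :
  on_cycle (a, b) (x :: p) <->
  consec (x :: p ++ [x]) a b \/ consec (x :: p ++ [x]) b a.
Proof.
  rewrite <- !cyclic_next; unfold on_cycle; simpl fst; simpl snd; split.
  - intros (i & [h | h]); [left | right]; eauto.
  - intros [(i & h) | (i & h)]; eauto.
Qed.

Lemma cycle_rotate {V} (adj : V -> V -> Prop) c v :
  is_cycle adj c -> In v c ->
  exists p, is_cycle adj (v :: p) /\
    (forall e, on_cycle e c -> on_cycle e (v :: p)) /\
    (forall z, In z c -> In z (v :: p)).
Proof.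
  intros hc hv; destruct (in_split _ _ hv) as (l1 & l2 & ->).
  destruct l1 as [| x l1]; [exists l2; auto |].
  assert (hcon : forall a b, consec (v :: (l2 ++ x :: l1) ++ [v]) a b <->
                             consec (x :: (l1 ++ v :: l2) ++ [x]) a b).
  { intros a b; rewrite <- !app_assoc; simpl app.
    change (v :: l2 ++ x :: l1 ++ [v]) with ((v :: l2) ++ x :: (l1 ++ [v])).
    change (x :: l1 ++ v :: l2 ++ [x]) with ((x :: l1) ++ v :: (l2 ++ [x])).
    rewrite (consec_app (v :: l2)), (consec_app (x :: l1)); simpl app; tauto. }
  simpl app in hc; exists (l2 ++ x :: l1); split; [| split].
  - apply is_cycle_cons in hc; apply is_cycle_cons; destruct hc as (h1 & h2 & h3).
    split; [| split].
    + rewrite length_app in h1 |- *; simpl in *; lia.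
    + change (NoDup ((x :: l1) ++ (v :: l2))) in h2.
      exact (Permutation_NoDup (Permutation_app_comm _ _) h2).
    + intros a b hab; apply h3, hcon, hab.
  - intros [a b]; simpl app; rewrite !on_cycle_cons, !hcon; auto.
  - intros z; change (In z ((x :: l1) ++ v :: l2) -> In z ((v :: l2) ++ x :: l1)).
    rewrite !in_app_iff; tauto.
Qed.

Lemma consec_reach {V} (adj : V -> V -> Prop) v l x y :
  (forall a b, adj a b -> adj b a) -> (forall a b, consec l a b -> adj a b) ->
  ~ In v l -> In x l -> In y l -> reach (adj_minus adj v) x y.
Proof.
  intros hs hl hv.
  assert (head : forall h t, (forall a b, consec (h :: t) a b -> adj a b) ->
    ~ In v (h :: t) -> forall z, In z (h :: t) -> reach (adj_minus adj v) h z).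
  { clear; intros h t; revert h; induction t as [| h' t IH]; intros h ht hv z hz.
    - destruct hz as [<- | []]; apply reach_refl.
    - destruct hz as [<- | hz]; [apply reach_refl |].
      apply reach_step with h'.
      + repeat split; [intros -> | intros -> | apply ht; left; auto];
          apply hv; simpl; auto.
      + apply IH; [intros a b hab; apply ht, consec_cons, hab | | exact hz].
        intros hin; apply hv; right; exact hin. }
  destruct l as [| h t]; [intros [] |]; intros hx hy.
  apply reach_trans with h; [apply reach_minus_sym; [exact hs |] |];
    apply (head h t); assumption.
Qed.

(** A cycle through [v], rotated to start there, is [v :: p], and the path [p] that remains avoids
    [v]. *)
Lemma cycle_reach_minus {V} (adj : V -> V -> Prop) c v x y :
  (forall a b, adj a b -> adj b a) -> is_cycle adj c ->
  In x c -> In y c -> x <> v -> y <> v -> reach (adj_minus adj v) x y.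
Proof.
  intros hs hc hx hy nx ny; destruct (classic (In v c)) as [hv | hv].
  - destruct (cycle_rotate _ _ _ hc hv) as (p & hp & _ & hin).
    apply is_cycle_cons in hp; destruct hp as (_ & hnd & hadj).
    destruct (hin _ hx) as [e | hx']; [congruence |].
    destruct (hin _ hy) as [e | hy']; [congruence |].
    apply consec_reach with p; auto.
    + intros a b hab; apply hadj, consec_cons, consec_appl, hab.
    + inversion hnd; assumption.
  - destruct c as [| z p]; [destruct hx |].
    apply is_cycle_cons in hc; destruct hc as (_ & _ & hadj).
    apply consec_reach with (z :: p); auto.
    intros a b hab; apply hadj.
    change (z :: p ++ [z]) with ((z :: p) ++ [z]); apply consec_appl, hab.
Qed.

(** * Equivalence of edges *)

Lemma on_cycle_in {V} (a b : V) c : on_cycle (a, b) c -> In a c /\ In b c.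
Proof. intros (i & [[h1 h2] | [h1 h2]]); split; eapply nth_error_In; eauto. Qed.

Lemma edge_equiv_refl {V} (adj : V -> V -> Prop) e : edge_equiv adj e e.
Proof. left; left; auto. Qed.

Lemma edge_equiv_swap_l {V} (adj : V -> V -> Prop) a b e :
  edge_equiv adj (a, b) e -> edge_equiv adj (b, a) e.
Proof.
  intros [h | (c & hc & h1 & h2)].
  - left; unfold same_edge in *; simpl in *; tauto.
  - right; exists c; split; [exact hc | split; [| exact h2]].
    destruct h1 as (i & h1); exists i; simpl in *; tauto.
Qed.

Lemma edge_equiv_swap_r {V} (adj : V -> V -> Prop) a b e :
  edge_equiv adj e (a, b) -> edge_equiv adj e (b, a).
Proof.
  intros [h | (c & hc & h1 & h2)].
  - left; unfold same_edge in *; simpl in *; tauto.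
  - right; exists c; split; [exact hc | split; [exact h1 |]].
    destruct h2 as (i & h2); exists i; simpl in *; tauto.
Qed.

(** No single vertex cuts a cycle. Read contrapositively, this shows that edges separated by a
    vertex are inequivalent, which is how copies are told apart in the canonical graph. *)
Lemma edge_equiv_reach_minus {V} (adj : V -> V -> Prop) v a b x y :
  (forall a b, adj a b -> adj b a) -> adj a b ->
  edge_equiv adj (a, b) (x, y) -> a <> v -> x <> v -> reach (adj_minus adj v) a x.
Proof.
  intros hs hab [h | (c & hc & h1 & h2)] na nx.
  - destruct h as [[h _] | [h h']]; simpl in *; subst; [apply reach_refl |].
    apply reach_one; repeat split; auto.
  - apply on_cycle_in in h1, h2; apply cycle_reach_minus with c; tauto.
Qed.

(** The walk is stopped at its first vertex [c] on [C] and freed of loops. [Q] lists what precedes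
    [c]; the last clause makes the path start at [z] even when [Q] is empty and [c = z]. *)
Lemma first_hit {V} (adj : V -> V -> Prop) (C : list V) v z u :
  z <> v -> reach (adj_minus adj v) z u -> In u C ->
  exists Q c, In c C /\ c <> v /\ NoDup Q /\ (forall q, In q Q -> ~ In q C /\ q <> v) /\
    (forall a b, consec (Q ++ [c]) a b -> adj a b) /\ exists T, Q ++ [c] = z :: T.
Proof.
  intros hz hr; revert hz; induction hr as [z | z y u h hr IH]; intros hz hu.
  - exists [], z; simpl; repeat split; auto; try tauto; try constructor.
    exists []; reflexivity.
  - destruct (classic (In z C)) as [hC | hC].
    { exists [], z; simpl; repeat split; auto; try tauto; try constructor.
      exists []; reflexivity. }
    destruct h as (_ & hy & h).
    destruct (IH hy hu) as (Q & c & h1 & h2 & h3 & h4 & h5 & T & h6).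
    destruct (classic (In z Q)) as [hQ | hQ].
    (* The path found so far returns to [z]; the loop is dropped by keeping only the part after that
       return. *)
    + destruct (in_split _ _ hQ) as (Q1 & Q2 & ->).
      exists (z :: Q2), c; split; [exact h1 |]; split; [exact h2 |]; repeat split.
      * clear -h3; induction Q1; [exact h3 | inversion h3; auto].
      * apply h4, in_or_app; right; assumption.
      * apply h4, in_or_app; right; assumption.
      * intros a b hab; apply h5.
        rewrite <- app_assoc; simpl; apply consec_app; right; exact hab.
      * exists (Q2 ++ [c]); reflexivity.
    + exists (z :: Q), c; split; [exact h1 |]; split; [exact h2 |]; repeat split.
      * constructor; assumption.
      * destruct H as [<- | H]; [assumption | apply h4, H].
      * destruct H as [<- | H]; [assumption | apply h4, H].
      * intros a b; simpl app; rewrite h6; rewrite consec_cons2.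
        intros [[<- <-] | hab]; [exact h | apply h5; rewrite h6; exact hab].
      * exists (Q ++ [c]); reflexivity.
Qed.

(* The path from [z] to its first hit [c] on the cycle, together with the edge [vz], is an
   ear; the arc of the cycle between [v] and [c] that carries the given edge closes it up. *)
Lemma edge_equiv_ear {V} (adj : V -> V -> Prop) v u z p a b :
  simple_graph adj -> adj v z -> is_cycle adj (v :: p) -> In u p ->
  reach (adj_minus adj v) z u -> consec (v :: p ++ [v]) a b ->
  edge_equiv adj (a, b) (v, z).
Proof.
  intros [hs hirr] hvz hcyc hu hr hab.
  assert (hzv : z <> v) by (intros ->; apply (hirr _ hvz)).
  destruct (first_hit adj (v :: p) v z u hzv hr) as
    (Q & c & h1 & h2 & h3 & h4 & h5 & T & h6); [right; exact hu |].
  destruct h1 as [h1 | h1]; [congruence |].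
  destruct (in_split _ _ h1) as (A & B & ->).
  apply is_cycle_cons in hcyc; destruct hcyc as (_ & hnd & hadj).
  assert (hear : forall a b, consec (v :: Q ++ [c]) a b -> adj a b).
  { intros a' b'; rewrite h6, consec_cons2, <- h6.
    intros [[<- <-] | h]; [exact hvz | apply h5, h]. }
  replace (v :: (A ++ c :: B) ++ [v]) with ((v :: A) ++ c :: (B ++ [v])) in *
    by (rewrite <- app_assoc; reflexivity).
  assert (hndv : NoDup (v :: Q)).
  { constructor; [| exact h3]; intros h; apply (h4 v h); reflexivity. }
  rewrite consec_app in hab; destruct hab as [hab | hab].
  (* Two vertices do not form a cycle. In this degenerate case arc and ear are both the edge [vz],
     so the two edges coincide; the other arc is treated alike. *)
  - assert (hlen : (A = [] /\ Q = []) \/ 2 <= length (A ++ c :: rev Q)).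
    { rewrite length_app; simpl; rewrite length_rev.
      destruct A; destruct Q; simpl; auto; right; lia. }
    destruct hlen as [[-> ->] | hlen].
    { simpl in hab, h6; injection h6 as -> _; left; left; simpl; intuition congruence. }
    assert (heq : v :: (A ++ c :: rev Q) ++ [v] = (v :: A) ++ c :: (rev Q ++ [v]))
      by (rewrite <- app_assoc; reflexivity).
    assert (hrev : c :: rev Q ++ [v] = rev (v :: Q ++ [c]))
      by (simpl; rewrite rev_app_distr; reflexivity).
    right; exists (v :: A ++ c :: rev Q); split; [| split].
    + apply is_cycle_cons; split; [exact hlen | split].
      * replace (v :: A ++ c :: rev Q) with ((v :: A ++ [c]) ++ rev Q)
          by (simpl; rewrite <- app_assoc; reflexivity).
        apply NoDup_app.
        -- replace (v :: A ++ c :: B) with ((v :: A ++ [c]) ++ B) in hnd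
             by (simpl; rewrite <- app_assoc; reflexivity).
           apply NoDup_app_remove_r in hnd; exact hnd.
        -- apply NoDup_rev, h3.
        -- intros q hq1 hq2; apply in_rev, h4 in hq2; destruct hq2 as [hq2 _].
           apply hq2; simpl in *; rewrite !in_app_iff in *; simpl in *; tauto.
      * rewrite heq; intros a' b'; rewrite consec_app; intros [h | h].
        -- apply hadj; rewrite consec_app; left; exact h.
        -- rewrite hrev in h; apply hs, hear, consec_rev, h.
    + rewrite on_cycle_cons, heq; left; rewrite consec_app; left; exact hab.
    + rewrite on_cycle_cons, heq; right; rewrite consec_app; right.
      rewrite hrev; apply consec_rev; rewrite rev_involutive, h6; simpl; auto.
  - assert (hlen : (B = [] /\ Q = []) \/ 2 <= length (Q ++ c :: B)).
    { rewrite length_app; simpl; destruct B; destruct Q; simpl; auto; right; lia. }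
    destruct hlen as [[-> ->] | hlen].
    { simpl in hab, h6; injection h6 as -> _; left; right; simpl; intuition congruence. }
    assert (heq : v :: (Q ++ c :: B) ++ [v] = (v :: Q) ++ c :: (B ++ [v]))
      by (rewrite <- app_assoc; reflexivity).
    right; exists (v :: Q ++ c :: B); split; [| split].
    + apply is_cycle_cons; split; [exact hlen | split].
      * change (v :: Q ++ c :: B) with ((v :: Q) ++ c :: B).
        apply NoDup_app; [exact hndv | |].
        -- change (NoDup ((v :: A) ++ c :: B)) in hnd.
           apply NoDup_app_remove_l in hnd; exact hnd.
        -- intros q [<- | hq1] hq2.
           ++ inversion hnd as [| ? ? hni]; apply hni, in_or_app; right; exact hq2.
           ++ apply (proj1 (h4 q hq1)); right; apply in_or_app; right; exact hq2.
      * rewrite heq; intros a' b'; rewrite consec_app; intros [h | h].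
        -- apply hear, h.
        -- apply hadj; rewrite consec_app; right; exact h.
    + rewrite on_cycle_cons, heq; left; rewrite consec_app; right; exact hab.
    + rewrite on_cycle_cons, heq; left; rewrite consec_app; left.
      simpl app; rewrite h6; simpl; auto.
Qed.

(** Transitivity in pivot form, around a common end [v]. If [e] is the edge [vu], a path from [z] to
    [u] off [v] closes up with [vz] and [vu] to a cycle; otherwise a cycle carries [e] and [vu], and
    the path from [z] to it gives an ear. *)
Lemma edge_equiv_step {V} (adj : V -> V -> Prop) e v u z :
  simple_graph adj -> adj v u -> adj v z -> edge_equiv adj e (v, u) ->
  reach (adj_minus adj v) u z -> edge_equiv adj e (v, z).
Proof.
  intros hG hvu hvz he hr; pose proof hG as [hs hirr]; destruct e as [a b].
  apply reach_minus_sym in hr; [| exact hs].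
  assert (hzv : z <> v) by (intros ->; apply (hirr _ hvz)).
  assert (huv : u <> v) by (intros ->; apply (hirr _ hvu)).
  destruct he as [he | (c & hc & h1 & h2)].
  - enough (h : edge_equiv adj (v, u) (v, z)).
    { destruct he as [[e1 e2] | [e1 e2]]; simpl in *; subst; [exact h |].
      apply edge_equiv_swap_l, h. }
    destruct (first_hit adj [u] v z u hzv hr) as
      (Q & c & h1 & h2 & h3 & h4 & h5 & T & h6); [left; reflexivity |].
    destruct h1 as [<- | []].
    destruct Q as [| q Q].
    { simpl in h6; injection h6 as -> _; apply edge_equiv_refl. }
    right; exists (v :: (q :: Q) ++ [u]).
    assert (heq : v :: ((q :: Q) ++ [u]) ++ [v] = (v :: q :: Q) ++ u :: [v])
      by (rewrite <- app_assoc; reflexivity).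
    assert (hear : forall a b, consec ((v :: q :: Q) ++ [u]) a b <->
      (v = a /\ z = b) \/ consec ((q :: Q) ++ [u]) a b).
    { intros a' b'; simpl app; simpl in h6; rewrite h6; apply consec_cons2. }
    split; [| split].
    + apply is_cycle_cons; split; [simpl; rewrite length_app; simpl; lia | split].
      * constructor.
        -- rewrite in_app_iff; intros [h | [h | []]]; [| congruence].
           apply (h4 v h); reflexivity.
        -- apply NoDup_app; [exact h3 | repeat constructor; tauto |].
           intros x hx hx'; apply (proj1 (h4 x hx)), hx'.
      * rewrite heq; intros a' b'; rewrite consec_app, hear; intros [[[<- <-] | h] | h].
        -- exact hvz.
        -- apply h5, h.
        -- simpl in h; destruct h as [[<- <-] | []]; apply hs, hvu.
    + rewrite on_cycle_cons, heq; right; rewrite consec_app; right; simpl; auto.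
    + rewrite on_cycle_cons, heq; left; rewrite consec_app, hear; auto.
  - destruct (on_cycle_in _ _ _ h2) as [hv hu].
    destruct (cycle_rotate _ _ _ hc hv) as (p & hp & hon & hin).
    destruct (hin _ hu) as [e | hu']; [congruence |].
    apply hon in h1; apply on_cycle_cons in h1; destruct h1 as [h1 | h1].
    + apply (edge_equiv_ear adj v u z p); assumption.
    + apply edge_equiv_swap_l, (edge_equiv_ear adj v u z p); assumption.
Qed.

(** Follow a walk from [b] to [c]: successive edges meet in a vertex, and biconnectedness joins
    their other ends off that vertex, so the equivalence pivots from each edge to the next. *)
Lemma edge_equiv_biconnected_image {V0 V} (adj0 : V0 -> V0 -> Prop) (adj : V -> V -> Prop)
  (s : V0 -> V) e a b c d :
  simple_graph adj0 -> biconnected adj0 -> simple_graph adj ->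
  (forall x y, s x = s y -> x = y) -> (forall x y, adj0 x y -> adj (s x) (s y)) ->
  adj0 a b -> adj0 c d -> edge_equiv adj e (s a, s b) -> edge_equiv adj e (s c, s d).
Proof.
  intros hG0 ((_ & hcon) & _ & hbic) hG hinj hs hab hcd he.
  assert (step : forall x y z, adj0 x y -> adj0 y z -> edge_equiv adj e (s x, s y) ->
    edge_equiv adj e (s y, s z)).
  { intros x y z hxy hyz hxy'; apply edge_equiv_step with (s x); auto.
    - apply hs, hG0, hxy.
    - apply edge_equiv_swap_r, hxy'.
    - apply reach_map with (adj_minus adj0 y).
      + intros x' y' (h1 & h2 & h3); repeat split; auto.
      + apply hbic; intros ->; eapply hG0; eassumption. }
  revert a hab he; generalize (hcon b c) as hr; intros hr.
  induction hr as [b | b b' c hbb' _ IH]; intros a hab he.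
  - apply step with a; assumption.
  - apply (IH hcd b hbb'), (step a); assumption.
Qed.

(** * Cardinalities *)

Definition below (n : nat) (c : option nat) : Prop :=
  match c with Some m => n < m | None => True end.

Definition enumerates {T} (g : nat -> T) (A : T -> Prop) (c : option nat) : Prop :=
  (forall m n, below m c -> below n c -> g m = g n -> m = n) /\
  (forall x, A x <-> exists n, below n c /\ g n = x).

Lemma enumerates_has_card {T} (g : nat -> T) A c : enumerates g A c -> has_card A c.
Proof.
  assert (hnd : forall m, (forall i j, i < m -> j < m -> g i = g j -> i = j) ->
    NoDup (map g (seq 0 m))).
  { intros m hm; apply NoDup_map_NoDup_ForallPairs; [| apply seq_NoDup].
    intros i j hi hj; apply in_seq in hi, hj; apply hm; lia. }
  intros [hinj hsur]; destruct c as [m |]; simpl in *.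
  - exists (map g (seq 0 m)); split; [| split].
    + apply hnd; auto.
    + rewrite length_map, length_seq; reflexivity.
    + intros x; rewrite hsur, in_map_iff; split.
      * intros (n & h & e); exists n; rewrite in_seq; split; [exact e | lia].
      * intros (n & e & h); apply in_seq in h; exists n; split; [lia | exact e].
  - intros (l & hl).
    assert (h : length (map g (seq 0 (S (length l)))) <= length l).
    { apply NoDup_incl_length; [apply hnd; auto |].
      intros x hx; apply hl, hsur; apply in_map_iff in hx; firstorder. }
    rewrite length_map, length_seq in h; lia.
Qed.

Lemma least_above (P : nat -> Prop) m :
  (exists n, m <= n /\ P n) ->
  exists n, m <= n /\ P n /\ forall k, m <= k -> k < n -> ~ P k.
Proof.
  intros (n & hn & hP); revert hn hP; induction n as [n IH] using lt_wf_ind; intros hn hP.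
  destruct (classic (exists k, m <= k /\ k < n /\ P k)) as [(k & h1 & h2 & h3) | h].
  - apply (IH k); assumption.
  - exists n; repeat split; auto; intros k h1 h2 h3; apply h; exists k; auto.
Qed.

Lemma unbounded_enumeration (P : nat -> Prop) :
  (forall m, exists n, m <= n /\ P n) ->
  exists e : nat -> nat, (forall i j, e i = e j -> i = j) /\
    (forall n, P n <-> exists i, e i = n).
Proof.
  intros hP; destruct (functional_choice _ (fun m => least_above P m (hP m))) as (nx & hnx).
  set (e := fix e i := match i with 0 => nx 0 | S i => nx (S (e i)) end).
  assert (hlt : forall i j, i < j -> e i < e j).
  { intros i j hij; induction hij as [| j _ IH].
    - destruct (hnx (S (e i))) as [h _]; exact h.
    - destruct (hnx (S (e j))) as [h _]; simpl; lia. }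
  assert (hge : forall i, i <= e i).
  { induction i as [| i IH]; [lia |]; specialize (hlt i (S i)); lia. }
  exists e; split.
  - intros i j hij; destruct (Nat.lt_trichotomy i j) as [h | [h | h]]; auto;
      apply hlt in h; lia.
  - intros k; split.
    (* Choosing least elements, [e] cannot jump over [k]; since [k <= e k], it cannot stay below [k]
       either. *)
    + intros hk.
      assert (h : forall i, e i < k \/ exists i, e i = k).
      { induction i as [| i [IH | IH]]; [| | right; exact IH]; simpl.
        - destruct (hnx 0) as (_ & _ & h).
          destruct (Nat.lt_trichotomy (nx 0) k) as [h' | [h' | h']]; [auto | |].
          + right; exists 0; exact h'.
          + exfalso; apply (h k); auto; lia.
        - destruct (hnx (S (e i))) as (_ & _ & h).
          destruct (Nat.lt_trichotomy (nx (S (e i))) k) as [h' | [h' | h']]; [auto | |].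
          + right; exists (S i); exact h'.
          + exfalso; apply (h k); auto. }
      destruct (h k) as [h' | h']; [specialize (hge k); lia | exact h'].
    + intros ([| i] & <-); apply hnx.
Qed.

(** [has_card A None] says only that [A] is infinite. The injective [code] makes it countable: its
    codes are unbounded, hence enumerable in increasing order. *)
Lemma has_card_enumerates {T} (A : T -> Prop) c (code : T -> nat) (x0 : T) :
  (forall x y, A x -> A y -> code x = code y -> x = y) -> has_card A c ->
  exists g, enumerates g A c.
Proof.
  intros hcode; destruct c as [m |]; simpl.
  - intros (l & hnd & <- & hl); exists (fun n => nth n l x0); split; simpl.
    + intros i j hi hj; apply NoDup_nth; assumption.
    + intros x; rewrite hl; split.
      * apply In_nth.
      * intros (n & hn & <-); apply nth_In, hn.
  - intros hinf.
    destruct (unbounded_enumeration (fun n => exists x, A x /\ code x = n)) as (e & he & he').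
    { intros m; apply NNPP; intros hm; apply hinf.
      assert (h : forall k, exists l, forall x, A x -> code x < k -> In x l).
      { induction k as [| k (l & IH)]; [exists []; intros; lia |].
        destruct (classic (exists x, A x /\ code x = k)) as [(y & hy & hy') | hy].
        - exists (y :: l); intros x hx hlt; destruct (Nat.eq_dec (code x) k) as [h | h].
          + left; apply hcode; congruence.
          + right; apply IH; [exact hx | lia].
        - exists l; intros x hx hlt; apply IH; [exact hx |].
          enough (code x <> k) by lia; intros h; apply hy; eauto. }
      destruct (h m) as (l & hl); exists l; intros x hx; apply hl; [exact hx |].
      apply Nat.nle_gt; intros hle; apply hm; eauto. }
    destruct (functional_choice (fun n x => A x /\ code x = e n)) as (g & hg).
    { intros n; apply he'; eauto. }
    exists g; split.
    + intros i j _ _ hij; apply he.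
      destruct (hg i) as [_ <-], (hg j) as [_ <-]; congruence.
    + intros x; split.
      * intros hx; destruct (proj1 (he' (code x))) as (i & hi); [eauto |].
        exists i; split; [exact I |]; destruct (hg i); apply hcode; congruence.
      * intros (n & _ & <-); apply hg.
Qed.

(** Transposing two indices gives a chosen member the number 0, the number reserved for the parent
    copy in words. *)
Lemma has_card_enumerates_from {T} (A : T -> Prop) c (code : T -> nat) (x0 : T) :
  (forall x y, A x -> A y -> code x = code y -> x = y) -> has_card A c ->
  exists g, enumerates g A c /\ (A x0 -> g 0 = x0).
Proof.
  intros hcode hc; destruct (has_card_enumerates A c code x0 hcode hc) as (g & hinj & hsur).
  destruct (classic (A x0)) as [hx0 | hx0]; [| exists g; split; [split; assumption | tauto]].
  destruct (proj1 (hsur _) hx0) as (m & hm & hgm).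
  assert (h0 : below 0 c) by (destruct c; simpl in *; auto; lia).
  set (sw := fun n => if Nat.eq_dec n 0 then m else if Nat.eq_dec n m then 0 else n).
  assert (hb : forall n, below n c -> below (sw n) c).
  { intros n hn; unfold sw; destruct (Nat.eq_dec n 0), (Nat.eq_dec n m); assumption. }
  assert (hsw : forall n, sw (sw n) = n).
  { intros n; unfold sw; repeat (destruct Nat.eq_dec; try lia). }
  exists (fun n => g (sw n)); split; [split |].
  - intros i j hi hj h; apply hinj in h; auto; rewrite <- (hsw i), h; apply hsw.
  - intros x; rewrite hsur; split; intros (n & hn & e).
    + exists (sw n); split; [auto | rewrite hsw; exact e].
    + exists (sw n); auto.
  - intros _; exact hgm.
Qed.

(** * Lobes and branches *)

Lemma lobe_adj {V} (adj : V -> V -> Prop) L x y : is_lobe adj L -> L (x, y) -> adj x y.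
Proof. intros (a & b & _ & h) hL; apply h in hL; apply hL. Qed.

Lemma lobe_sym {V} (adj : V -> V -> Prop) L x y :
  simple_graph adj -> is_lobe adj L -> L (x, y) -> L (y, x).
Proof.
  intros [hs _] (a & b & _ & h); rewrite !h; intros [h1 h2]; split.
  - apply hs, h1.
  - apply edge_equiv_swap_r, h2.
Qed.

Lemma lobe_of_edge {V} (adj : V -> V -> Prop) x y :
  adj x y -> exists L, is_lobe adj L /\ L (x, y).
Proof.
  intros h; exists (fun e => adj (fst e) (snd e) /\ edge_equiv adj (x, y) e); split.
  - exists x, y; split; [exact h | tauto].
  - split; [exact h | apply edge_equiv_refl].
Qed.

(** What hangs off [v] through [L]. When [L] is a copy of a biconnected graph, this is a single
    component of the graph minus [v], since the rest of [L] stays connected. *)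
Definition branch {V} (adj : V -> V -> Prop) (v : V) (L : V * V -> Prop) (x : V) : Prop :=
  x <> v /\ exists y, lobe_vtx L y /\ y <> v /\ reach (adj_minus adj v) y x.

Section BiconnectedLobes.
Context {V0 : Type} {adj0 : V0 -> V0 -> Prop} {V : Type} {adj : V -> V -> Prop}
  {sigma : (V * V -> Prop) -> V0 -> V}
  (hG0 : simple_graph adj0) (hbic : biconnected adj0) (hG : simple_graph adj)
  (hsigma : forall L, is_lobe adj L -> lobe_iso adj0 L (sigma L)).

Lemma lobe_edge_preimage L x y : is_lobe adj L -> L (x, y) ->
  exists a b, adj0 a b /\ sigma L a = x /\ sigma L b = y.
Proof.
  intros hL h; destruct (hsigma L hL) as (_ & _ & h3 & h4).
  destruct (h3 x) as (a & <-); [exists y; exact h |].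
  destruct (h3 y) as (b & <-); [exists (sigma L a); apply (lobe_sym adj); assumption |].
  exists a, b; rewrite h4; auto.
Qed.

Lemma sigma_adj L a b : is_lobe adj L -> adj0 a b -> adj (sigma L a) (sigma L b).
Proof.
  intros hL hab; apply (lobe_adj adj L); [exact hL |]; apply hsigma; assumption.
Qed.

Lemma lobe_reach_minus L v x y : is_lobe adj L -> lobe_vtx L x -> lobe_vtx L y ->
  x <> v -> y <> v -> reach (adj_minus adj v) x y.
Proof.
  intros hL hx hy nx ny; destruct (hsigma L hL) as (_ & h2 & h3 & _).
  destruct (h3 x hx) as (a & <-), (h3 y hy) as (b & <-).
  destruct hbic as ((_ & hcon) & _ & hb).
  destruct (classic (exists c, sigma L c = v)) as [(c & <-) | hv].
  - apply reach_map with (adj_minus adj0 c).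
    + intros a' b' (n1 & n2 & h); repeat split; auto; apply sigma_adj; auto.
    + apply hb; congruence.
  - apply reach_map with adj0; [| apply hcon].
    intros a' b' h; split; [| split]; [intros e; apply hv; eauto .. | apply sigma_adj; auto].
Qed.

(** A lobe consists of the edges equivalent to one fixed edge, so disjointness of lobes amounts to
    transitivity; here it comes from [L] being the image of the biconnected [adj0]. *)
Lemma lobe_eq_of_common_edge L L' e :
  is_lobe adj L -> is_lobe adj L' -> L e -> L' e -> L = L'.
Proof.
  assert (sub : forall L L', is_lobe adj L -> is_lobe adj L' -> L e -> L' e ->
    forall e', L e' -> L' e').
  { intros L1 L2 h1 h2 he1 he2 e' he'; destruct e as [x y], e' as [x' y'].
    destruct (lobe_edge_preimage _ _ _ h1 he1) as (a & b & hab & <- & <-).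
    destruct (lobe_edge_preimage _ _ _ h1 he') as (c & d & hcd & <- & <-).
    pose proof h2 as (p & q & _ & hpq); apply hpq; split.
    - apply sigma_adj; assumption.
    - apply (edge_equiv_biconnected_image adj0 adj (sigma L1)) with a b; auto.
      + apply hsigma, h1.
      + intros; apply sigma_adj; assumption.
      + apply hpq, he2. }
  intros h h' he he'; apply functional_extensionality; intros e'.
  apply propositional_extensionality; split; apply sub; assumption.
Qed.

(** Neighbours of [v] in [L] and in [L'] are joined off [v] by way of [y] and [y']; pivoting at [v]
    puts an edge of [L'] into the class [L]. *)
Lemma lobe_cut L L' v y y' : is_lobe adj L -> is_lobe adj L' ->
  lobe_vtx L v -> lobe_vtx L' v -> lobe_vtx L y -> lobe_vtx L' y' ->
  y <> v -> y' <> v -> reach (adj_minus adj v) y y' -> L = L'.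
Proof.
  intros hL hL' (x & hx) (x' & hx') hy hy' ny ny' hr.
  assert (irr : forall z M, is_lobe adj M -> M (v, z) -> z <> v).
  { intros z M hM hz ->; apply lobe_adj with (adj := adj) in hz; [| exact hM].
    eapply hG; eassumption. }
  apply lobe_eq_of_common_edge with (v, x'); auto.
  pose proof hL as (p & q & _ & hpq); apply hpq; split.
  - apply (lobe_adj adj L'); assumption.
  - apply edge_equiv_step with x; auto.
    + apply (lobe_adj adj L); assumption.
    + apply (lobe_adj adj L'); assumption.
    + apply hpq, hx.
    + apply reach_trans with y; [| apply reach_trans with y'; [exact hr |]].
      * apply (lobe_reach_minus L); eauto; exists v; apply (lobe_sym adj); assumption.
      * apply (lobe_reach_minus L'); eauto; exists v; apply (lobe_sym adj); assumption.
Qed.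

Lemma branch_disjoint L L' v x : is_lobe adj L -> is_lobe adj L' -> L <> L' ->
  lobe_vtx L v -> lobe_vtx L' v -> branch adj v L x -> branch adj v L' x -> False.
Proof.
  intros hL hL' hne hv hv' (_ & y & hy & ny & hr) (_ & y' & hy' & ny' & hr').
  apply hne, (lobe_cut L L' v y y'); auto.
  apply reach_trans with x; [exact hr | apply reach_minus_sym; [apply hG | exact hr']].
Qed.

Lemma branch_of_lobe_vtx L v x : lobe_vtx L x -> x <> v -> branch adj v L x.
Proof. intros hx nx; split; [exact nx |]; exists x; repeat split; auto using reach_refl. Qed.

(** Branches nest. A walk that leaves [L'] off [v] never meets [r], or [lobe_cut] would merge [L']
    with [L]; so it is also a walk off [r], and inside [L'] it connects back to [v]. *)
Lemma branch_incl L L' r v x : is_lobe adj L -> is_lobe adj L' -> L' <> L -> r <> v ->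
  lobe_vtx L r -> lobe_vtx L v -> lobe_vtx L' v -> branch adj v L' x -> branch adj r L x.
Proof.
  intros hL hL' hne hrv hr hv hv' (nx & y & hy & ny & hyx).
  assert (hoff : forall z, reach (adj_minus adj v) y z -> z <> r).
  { intros z hz ->; apply hne, (lobe_cut L' L v y r); auto. }
  split; [apply hoff, hyx |]; exists v; repeat split; auto.
  apply reach_trans with y.
  - apply (lobe_reach_minus L'); auto; apply hoff, reach_refl.
  - clear nx hy ny; revert hoff; induction hyx as [y | y y' x h _ IH]; intros hoff;
      [apply reach_refl |].
    apply reach_step with y'.
    + repeat split; [apply hoff, reach_refl | apply hoff, reach_one, h | apply h].
    + apply IH; intros z hz; apply hoff, reach_step with y'; assumption.
Qed.

Lemma branch_disjoint_lobe L L' v x : is_lobe adj L -> is_lobe adj L' -> L' <> L ->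
  lobe_vtx L v -> lobe_vtx L' v -> lobe_vtx L x -> branch adj v L' x -> False.
Proof.
  intros hL hL' hne hv hv' hx hb; apply (branch_disjoint L' L v x); auto.
  apply branch_of_lobe_vtx; [exact hx | apply hb].
Qed.

(** Seen from [v2], the branch of [L1] lies inside the branch of [L], and distinct lobes at [v2]
    have disjoint branches. *)
Lemma branch_disjoint_along L L1 L2 v1 v2 x :
  is_lobe adj L -> is_lobe adj L1 -> is_lobe adj L2 -> L1 <> L -> L2 <> L -> v1 <> v2 ->
  lobe_vtx L v1 -> lobe_vtx L v2 -> lobe_vtx L1 v1 -> lobe_vtx L2 v2 ->
  branch adj v1 L1 x -> branch adj v2 L2 x -> False.
Proof.
  intros hL hL1 hL2 n1 n2 nv hv1 hv2 hv1' hv2' hx1 hx2.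
  apply (branch_disjoint L2 L v2 x); auto.
  apply (branch_incl L L1 v2 v1); auto.
Qed.

Lemma lobes_countable : countable_vtx V ->
  exists code : (V * V -> Prop) -> nat,
    forall L L', is_lobe adj L -> is_lobe adj L' -> code L = code L' -> L = L'.
Proof.
  intros (f & hf).
  destruct (functional_choice (fun L n => is_lobe adj L ->
    exists x y, L (x, y) /\ n = to_nat (f x, f y))) as (code & hcode).
  { intros L; destruct (classic (is_lobe adj L)) as [hL | hL]; [| exists 0; tauto].
    destruct (hL) as (x & y & hxy & h); exists (to_nat (f x, f y)); intros _.
    exists x, y; split; [apply h; split; [exact hxy | apply edge_equiv_refl] | reflexivity]. }
  exists code; intros L L' hL hL' e.
  destruct (hcode L hL) as (x & y & hxy & e1), (hcode L' hL') as (x' & y' & hxy' & e2).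
  rewrite e1, e2 in e; apply to_nat_inj in e; injection e as ex ey.
  apply hf in ex, ey; subst; apply lobe_eq_of_common_edge with (x', y'); assumption.
Qed.

End BiconnectedLobes.

(** * The canonical tree of copies *)

Lemma edge_equiv_sym {V} (adj : V -> V -> Prop) e e' :
  edge_equiv adj e e' -> edge_equiv adj e' e.
Proof.
  intros [h | (c & hc & h1 & h2)].
  - left; unfold same_edge in *; intuition auto.
  - right; exists c; auto.
Qed.

Fixpoint list_code {T} (code : T -> nat) (l : list T) : nat :=
  match l with [] => 0 | x :: l => S (to_nat (code x, list_code code l)) end.

Lemma list_code_inj {T} (code : T -> nat) :
  (forall x y, code x = code y -> x = y) ->
  forall l l', list_code code l = list_code code l' -> l = l'.
Proof.
  intros hcode; induction l as [| x l IH]; intros [| x' l']; try discriminate; auto.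
  intros h; apply eq_add_S in h; apply to_nat_inj in h; injection h as h1 h2.
  f_equal; auto.
Qed.

Section Canonical.
(** Intended reading: [typ a] indexes the orbit of [a], [rep j] is a chosen member of orbit [j], and
    [kt a] indexes the block of the partition that contains [a]. *)
Context {V0 J K : Type} (adj0 : V0 -> V0 -> Prop) (mu : K -> J -> option nat)
  (typ : V0 -> J) (rep : J -> V0) (kt : V0 -> K).

(* A word addresses a copy of [V0], most recent branching first. The letter [(a, j, n)]
   branches off at position [a] of the parent copy to the [n]-th copy having its position
   [rep j] there; the parent itself counts as the [0]-th copy of type [typ a]. *)
Definition word : Type := list (V0 * J * nat).

Definition root_pos (w : word) : option V0 :=
  match w with (_, j, _) :: _ => Some (rep j) | [] => None end.

(** The root of a copy already belongs to its parent, and branchings there are recorded in the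
    parent; hence [root_pos w' <> Some a]. The last clause excludes the one letter that would name
    the parent itself. *)
Fixpoint valid (w : word) : Prop :=
  match w with
  | (a, j, n) :: w' =>
      valid w' /\ root_pos w' <> Some a /\ below n (mu (kt a) j) /\ ~ (j = typ a /\ n = 0)
  | [] => True
  end.

(** Normal addresses stand for the classes of the disjoint union of all copies modulo gluing. *)
Definition normal (x : word * V0) : Prop :=
  valid (fst x) /\ root_pos (fst x) <> Some (snd x).

Definition vertex : Type := {x : word * V0 | normal x}.

(* The root of a copy is identified with the position of its parent it branches off from. *)
Definition normalize (w : word) (a : V0) : word * V0 :=
  match w with
  | (b, j, _) :: w' => if excluded_middle_informative (a = rep j) then (w', b) else (w, a)
  | [] => (w, a)
  end.

(** One step up is enough: by validity of the letter, [b] is not the root of the parent copy. *)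
Lemma normalize_normal w a : valid w -> normal (normalize w a).
Proof.
  intros hw; destruct w as [| [[b j] n] w]; simpl.
  - split; [exact I | discriminate].
  - destruct excluded_middle_informative as [h | h].
    + split; apply hw.
    + split; [exact hw |]; simpl; congruence.
Qed.

Lemma normalize_id w a : root_pos w <> Some a -> normalize w a = (w, a).
Proof.
  destruct w as [| [[b j] n] w]; simpl; [reflexivity |]; intros h.
  destruct excluded_middle_informative; [congruence | reflexivity].
Qed.

Lemma normalize_root b j n w : normalize ((b, j, n) :: w) (rep j) = (w, b).
Proof. simpl; destruct excluded_middle_informative; congruence. Qed.

Lemma normalize_inj w a b : normalize w a = normalize w b -> a = b.
Proof.
  destruct w as [| [[c j] n] w]; simpl; [congruence |].
  assert (hne : forall l : V0 * J * nat, w <> l :: w).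
  { intros l h; apply (f_equal (@length _)) in h; simpl in h; lia. }
  repeat destruct excluded_middle_informative; congruence.
Qed.

Lemma vertex_eq (x y : vertex) : proj1_sig x = proj1_sig y -> x = y.
Proof. apply eq_sig_hprop; intros; apply proof_irrelevance. Qed.

Definition copy : Type := {w : word | valid w}.

Definition place (w : copy) (a : V0) : vertex :=
  exist _ (normalize (proj1_sig w) a) (normalize_normal _ a (proj2_sig w)).

Definition base : copy := exist _ [] I.

Definition cadj (x y : vertex) : Prop :=
  exists w a b, adj0 a b /\ place w a = x /\ place w b = y.

Definition copy_edges (w : copy) (e : vertex * vertex) : Prop :=
  exists a b, adj0 a b /\ place w a = fst e /\ place w b = snd e.

Lemma place_inj w a b : place w a = place w b -> a = b.
Proof. intros h; apply (f_equal (@proj1_sig _ _)) in h; apply normalize_inj in h; exact h. Qed.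

Lemma copy_eq (w u : copy) : proj1_sig w = proj1_sig u -> w = u.
Proof. apply eq_sig_hprop; intros; apply proof_irrelevance. Qed.

Lemma vertex_placed (x : vertex) : exists w : copy, x = place w (snd (proj1_sig x)) /\
  proj1_sig w = fst (proj1_sig x).
Proof.
  destruct x as [[w a] h]; exists (exist _ w (proj1 h)); split; [| reflexivity].
  apply vertex_eq; simpl; symmetry; apply normalize_id, h.
Qed.

Lemma place_root (w : copy) b j n w' : proj1_sig w = (b, j, n) :: w' ->
  exists u : copy, proj1_sig u = w' /\ place w (rep j) = place u b.
Proof.
  destruct w as [w hw]; simpl; intros ->; pose proof hw as (h1 & h2 & _).
  exists (exist _ w' h1); split; [reflexivity |]; apply vertex_eq.
  change (normalize ((b, j, n) :: w') (rep j) = normalize w' b).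
  rewrite normalize_root, normalize_id; auto.
Qed.

Definition descends (w u : word) : Prop := exists q, w = q ++ u.

Lemma normalize_descends w u a : descends (fst (normalize w a)) u -> descends w u.
Proof.
  destruct w as [| [[b j] n] w]; simpl; [auto |].
  destruct excluded_middle_informative; simpl; auto.
  intros (q & ->); exists ((b, j, n) :: q); reflexivity.
Qed.

Lemma descends_normalize w b j n u a : descends w ((b, j, n) :: u) ->
  normalize w a <> (u, b) -> descends (fst (normalize w a)) ((b, j, n) :: u).
Proof.
  intros (q & ->); destruct q as [| [[c j'] n'] q]; simpl;
    destruct excluded_middle_informative; simpl.
  - congruence.
  - intros _; exists []; reflexivity.
  - intros _; exists q; reflexivity.
  - intros _; exists ((c, j', n') :: q); reflexivity.
Qed.

(** The vertices other than [v] in copies below [u] are closed under adjacency off [v]: an edge lies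
    in one copy, that copy descends from [u] as soon as one end does, and then so does the address
    of its other end unless it is [v]. *)
Lemma copies_separated (w u : copy) b j n u' (v : vertex) x y :
  proj1_sig u = (b, j, n) :: u' -> proj1_sig v = (u', b) ->
  ~ descends (proj1_sig w) (proj1_sig u) -> place u x <> v ->
  ~ reach (adj_minus cadj v) (place u x) (place w y).
Proof.
  intros hu hv hnd hne hr; apply hnd; rewrite hu.
  apply (normalize_descends _ _ y).
  change (descends (fst (proj1_sig (place w y))) ((b, j, n) :: u')).
  revert hr; apply (reach_closed _ (fun z => descends (fst (proj1_sig z)) ((b, j, n) :: u'))).
  - intros s t hs (_ & hnt & t0 & c & d & _ & <- & <-).
    apply normalize_descends in hs; apply descends_normalize; [exact hs |].
    intros e; apply hnt, vertex_eq; rewrite hv; exact e.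
  - apply descends_normalize; [exists []; exact hu |].
    intros e; apply hne, vertex_eq; rewrite hv; exact e.
Qed.

(** * The lobes of the canonical graph *)

Context (hG0 : simple_graph adj0) (hbic : biconnected adj0).

Lemma cadj_simple : simple_graph cadj.
Proof.
  split.
  - intros x y (w & a & b & h & h1 & h2); exists w, b, a; repeat split; auto; apply hG0, h.
  - intros x (w & a & b & h & h1 & h2); rewrite <- h2 in h1; apply place_inj in h1; subst.
    eapply hG0; eassumption.
Qed.

Lemma place_adj w a b : adj0 a b -> cadj (place w a) (place w b).
Proof. intros h; exists w, a, b; auto. Qed.

(** Of two distinct words one does not descend from the other, say [w] from [u]; then the root
    vertex of [u] separates the copies. Every edge has an end off that vertex, so swapping ends
    reduces to that case. *)
Lemma copies_not_equiv w u a b c d : w <> u -> adj0 a b -> adj0 c d ->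
  ~ edge_equiv cadj (place w a, place w b) (place u c, place u d).
Proof.
  assert (key : forall w u a b c d, ~ descends (proj1_sig w) (proj1_sig u) ->
    adj0 a b -> adj0 c d ->
    ~ edge_equiv cadj (place w a, place w b) (place u c, place u d)).
  { clear w u a b c d; intros w u a b c d hnd hab hcd he.
    destruct (proj1_sig u) as [| [[p j] n] u'] eqn:hu.
    { apply hnd; exists (proj1_sig w); rewrite app_nil_r; reflexivity. }
    destruct (place_root u p j n u' hu) as (t & ht & _).
    assert (hv : proj1_sig (place t p) = (u', p)).
    { simpl; rewrite ht; apply normalize_id.
      pose proof (proj2_sig u) as h; simpl in h; rewrite hu in h; apply h. }
    rewrite <- hu in hnd.
    assert (off : forall w a b, adj0 a b -> place w a <> place t p \/ place w b <> place t p).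
    { intros w' a' b' h; destruct (classic (place w' a' = place t p)) as [e | e]; [| auto].
      right; rewrite <- e; intros e'; apply place_inj in e'; subst; eapply hG0; eassumption. }
    pose proof cadj_simple as [hs _].
    assert (main : forall a b c d, adj0 a b ->
      edge_equiv cadj (place w a, place w b) (place u c, place u d) ->
      place w a <> place t p -> place u c <> place t p -> False).
    { clear a b c d hab hcd he; intros a b c d hab he n1 n2.
      eapply (copies_separated w u p j n u' (place t p)); eauto.
      apply reach_minus_sym; [exact hs |].
      eapply edge_equiv_reach_minus; eauto; apply place_adj; eassumption. }
    assert (hba : adj0 b a) by apply hG0, hab.
    destruct (off w a b hab) as [n1 | n1], (off u c d hcd) as [n2 | n2].
    - apply (main a b c d); auto.
    - apply (main a b d c); auto using edge_equiv_swap_r.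
    - apply (main b a c d); auto using edge_equiv_swap_l.
    - apply (main b a d c); auto using edge_equiv_swap_l, edge_equiv_swap_r. }
  intros hne hab hcd he.
  destruct (classic (descends (proj1_sig w) (proj1_sig u))) as [[q hq] | h].
  - destruct (classic (descends (proj1_sig u) (proj1_sig w))) as [[q' hq'] | h].
    + apply hne, copy_eq; rewrite hq' in hq.
      destruct q; [| apply (f_equal (@length _)) in hq; simpl in hq;
                     rewrite !length_app in hq; lia].
      destruct q'; [| apply (f_equal (@length _)) in hq; simpl in hq;
                      rewrite !length_app in hq; lia].
      symmetry; exact hq'.
    + apply (key u w c d a b); auto using edge_equiv_sym.
  - apply (key w u a b c d); auto.
Qed.

(** Biconnectedness of [adj0] keeps a copy within one class, and inequivalence across copies keeps
    the class within the copy. *)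
Lemma copy_edges_class w a b e : adj0 a b ->
  (copy_edges w e <-> cadj (fst e) (snd e) /\ edge_equiv cadj (place w a, place w b) e).
Proof.
  intros hab; destruct e as [x y]; split.
  - intros (c & d & hcd & h1 & h2); simpl in *; subst; split; [apply place_adj, hcd |].
    apply (edge_equiv_biconnected_image adj0 cadj (place w)) with a b;
      auto using cadj_simple, place_adj, edge_equiv_refl.
    apply place_inj.
  - simpl; intros [(u & c & d & hcd & <- & <-) he].
    destruct (classic (w = u)) as [<- | hne]; [exists c, d; auto |].
    exfalso; eapply copies_not_equiv; [exact hne | | | exact he]; assumption.
Qed.

Lemma base_edge : exists a b, adj0 a b.
Proof.
  destruct hbic as ((_ & hcon) & (a & b & _ & hne & _) & _).
  destruct (hcon a b) as [x | x y z h _]; [congruence | eauto].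
Qed.

Lemma is_lobe_copy w : is_lobe cadj (copy_edges w).
Proof.
  destruct base_edge as (a & b & hab); exists (place w a), (place w b).
  split; [apply place_adj, hab |]; intros e; apply copy_edges_class, hab.
Qed.

Lemma lobe_is_copy L : is_lobe cadj L -> exists w, L = copy_edges w.
Proof.
  intros (x & y & (w & a & b & hab & <- & <-) & hL); exists w.
  apply functional_extensionality; intros e; apply propositional_extensionality.
  rewrite hL; symmetry; apply copy_edges_class, hab.
Qed.

Lemma copy_edges_inj w u : copy_edges w = copy_edges u -> w = u.
Proof.
  intros h; apply NNPP; intros hne; destruct base_edge as (a & b & hab).
  assert (hw : copy_edges w (place w a, place w b)) by (exists a, b; auto).
  rewrite h in hw; apply (copy_edges_class u a b) in hw; [| exact hab].
  destruct hw as [_ hw]; revert hw; apply copies_not_equiv; auto.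
Qed.

Lemma copy_edges_iso w : lobe_iso adj0 (copy_edges w) (place w).
Proof.
  repeat split.
  - intros a; destruct hbic as ((_ & hcon) & (c & d & _ & hne & _) & _).
    assert (exists b, adj0 a b) as (b & hab).
    { destruct (classic (a = c)) as [-> | h].
      - destruct (hcon c d) as [| x y z h _]; [congruence | eauto].
      - destruct (hcon a c) as [| x y z h' _]; [congruence | eauto]. }
    exists (place w b), a, b; auto.
  - apply place_inj.
  - intros v (v' & a & b & _ & h & _); exists a; exact h.
  - intros h; exists a, b; auto.
  - intros (c & d & h & h1 & h2); simpl in *; apply place_inj in h1, h2; subst; exact h.
Qed.

Lemma cadj_connected : connected cadj.
Proof.
  pose proof hbic as ((_ & hcon) & (o & _) & _); split; [exists (place base o); exact I |].
  assert (h : forall w a, reach cadj (place w a) (place base o)).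
  { assert (h : forall l w, proj1_sig w = l -> forall a, reach cadj (place w a) (place base o)).
    { induction l as [| [[b j] n] l IH]; intros w hw a.
      - replace w with base by (apply copy_eq; symmetry; exact hw).
        apply reach_map with adj0; [apply place_adj | apply hcon].
      - destruct (place_root w b j n l hw) as (u & hu & e).
        apply reach_trans with (place w (rep j)).
        + apply reach_map with adj0; [apply place_adj | apply hcon].
        + rewrite e; apply IH, hu. }
    intros w; apply (h (proj1_sig w)); reflexivity. }
  intros x y; destruct (vertex_placed x) as (w & -> & _), (vertex_placed y) as (u & -> & _).
  eapply reach_trans; [apply h | apply reach_sym; [apply cadj_simple | apply h]].
Qed.

Lemma vertex_countable : countable_vtx V0 -> (forall j, typ (rep j) = j) ->
  countable_vtx vertex.
Proof.
  intros (f & hf) hrep.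
  (* [J] has no coding of its own; [rep] embeds it into [V0], with left inverse [typ]. *)
  set (lc := fun l : V0 * J * nat => let '(a, j, n) := l in to_nat (f a, to_nat (f (rep j), n))).
  assert (hlc : forall l l', lc l = lc l' -> l = l').
  { intros [[a j] n] [[a' j'] n'] h; apply to_nat_inj, pair_equal_spec in h; destruct h as [h1 h2].
    apply to_nat_inj, pair_equal_spec in h2; destruct h2 as [h2 h3]; apply hf in h1, h2.
    rewrite <- (hrep j), <- (hrep j'); congruence. }
  exists (fun x => to_nat (list_code lc (fst (proj1_sig x)), f (snd (proj1_sig x)))).
  intros [[w a] hx] [[u b] hy] h; cbn [proj1_sig fst snd] in h.
  apply to_nat_inj, pair_equal_spec in h; destruct h as [h1 h2].
  apply list_code_inj in h1; [| exact hlc]; apply hf in h2; apply vertex_eq.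
  simpl; congruence.
Qed.

(** * Counting the lobes of each type at a vertex of the canonical graph *)

Context (Q : J -> V0 -> Prop) (hQ : forall j a, Q j a <-> typ a = j)
  (hrep : forall j, typ (rep j) = j) (hmu : forall a, mu (kt a) (typ a) <> Some 0).

(** Through the vertex [(w, a)] pass [w] and its children at [a]. The copy [w] takes the index that
    validity denies to children, number 0 of type [typ a]; [hmu] ensures that this index lies in
    range. *)
Lemma copies_at_vertex (x : vertex) j : enumerates
  (fun n => if excluded_middle_informative (j = typ (snd (proj1_sig x)) /\ n = 0)
            then fst (proj1_sig x)
            else (snd (proj1_sig x), j, n) :: fst (proj1_sig x))
  (fun w => valid w /\ exists a, Q j a /\ normalize w a = proj1_sig x)
  (mu (kt (snd (proj1_sig x))) j).
Proof.
  destruct x as [[w a] [hw ha]]; simpl in *; split.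
  - intros m n _ _.
    assert (hne : forall l : V0 * J * nat, w <> l :: w).
    { intros l h; apply (f_equal (@length _)) in h; simpl in h; lia. }
    repeat destruct excluded_middle_informative; intros h.
    + intuition congruence.
    + apply hne in h; contradiction.
    + symmetry in h; apply hne in h; contradiction.
    + congruence.
  - intros u; split.
    + intros (hu & b & hb & e); apply hQ in hb; destruct u as [| [[c j'] n] u]; simpl in e.
      { injection e as <- <-; exists 0; split.
        - specialize (hmu b); rewrite hb in hmu.
          destruct (mu (kt b) j) as [[|] |]; simpl; auto; try lia; congruence.
        - destruct excluded_middle_informative as [h | h]; [reflexivity |].
          exfalso; apply h; auto. }
      destruct excluded_middle_informative as [h | h]; injection e as e1 e2; subst.
      * rewrite hrep in *; destruct hu as (h1 & h2 & h3 & h4); exists n; split; [exact h3 |].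
        destruct excluded_middle_informative; [contradiction | reflexivity].
      * exists 0; split.
        -- specialize (hmu a).
           destruct (mu (kt a) (typ a)) as [[|] |]; simpl; auto; try lia; congruence.
        -- destruct excluded_middle_informative as [h' | h']; [reflexivity |].
           exfalso; apply h'; auto.
    + intros (n & hn & <-); destruct excluded_middle_informative as [h | h].
      * split; [exact hw |]; exists a; split; [apply hQ; symmetry; apply h |].
        apply normalize_id, ha.
      * split; [simpl; tauto |]; exists (rep j).
        split; [apply hQ, hrep | apply normalize_root].
Qed.

(** [sigma] receives a lobe as an edge set, from which its word is recovered by choice;
    [copy_edges_inj] makes the answer unique. *)
Definition pick_copy (L : vertex * vertex -> Prop) : copy :=
  epsilon (inhabits base) (fun w => L = copy_edges w).

Lemma pick_copy_spec w : pick_copy (copy_edges w) = w.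
Proof.
  symmetry; apply copy_edges_inj, (epsilon_spec (inhabits base)
    (fun u => copy_edges w = copy_edges u)); exists w; reflexivity.
Qed.

Lemma canonical_lobe_iso L : is_lobe cadj L -> lobe_iso adj0 L (place (pick_copy L)).
Proof.
  intros hL; destruct (lobe_is_copy L hL) as (w & ->).
  rewrite pick_copy_spec; apply copy_edges_iso.
Qed.

Lemma canonical_count (x : vertex) j : has_card
  (fun L => is_lobe cadj L /\ exists a, Q j a /\ place (pick_copy L) a = x)
  (mu (kt (snd (proj1_sig x))) j).
Proof.
  pose proof (copies_at_vertex x j) as hg.
  match type of hg with enumerates ?f _ _ => set (g := f) in hg; clearbody g end.
  destruct hg as [hinj hsur].
  destruct (functional_choice (fun n (w : copy) =>
    below n (mu (kt (snd (proj1_sig x))) j) -> proj1_sig w = g n)) as (g' & hg').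
  { intros n; destruct (classic (valid (g n))) as [h | h]; [exists (exist _ _ h); auto |].
    exists base; intros hn; exfalso; apply h, hsur; eauto. }
  apply enumerates_has_card with (fun n => copy_edges (g' n)); split.
  - intros m n hm hn h; apply copy_edges_inj in h; apply hinj; auto.
    rewrite <- (hg' m), <- (hg' n), h by assumption; reflexivity.
  - intros L; split.
    + intros [hL (a & ha & e)]; destruct (lobe_is_copy L hL) as (w & ->).
      rewrite pick_copy_spec in e.
      destruct (proj1 (hsur (proj1_sig w))) as (n & hn & en).
      { split; [exact (proj2_sig w) |]; exists a; split; [exact ha | rewrite <- e; reflexivity]. }
      exists n; split; [exact hn |]; f_equal; apply copy_eq; rewrite hg'; assumption.
    + intros (n & hn & <-); split; [apply is_lobe_copy |]; rewrite pick_copy_spec.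
      destruct (proj2 (hsur (g n))) as (_ & a & ha & e); [eauto |].
      exists a; split; [exact ha |]; apply vertex_eq; simpl; rewrite hg'; assumption.
Qed.

Lemma canonical_connectivity1 k a : kt a = k -> card_sum_ge2 (mu k) -> connectivity1 cadj.
Proof.
  intros <- hsum; split; [apply cadj_connected |].
  (* A second copy at position [a] needs an index other than number 0 of [typ a]: number 1 of an
     infinite type, number 0 of another type with a nonzero entry, or else number 1 of [typ a],
     which then carries the whole sum. *)
  assert (exists j n, below n (mu (kt a) j) /\ ~ (j = typ a /\ n = 0)) as (j & n & hn & hne).
  { destruct hsum as [(j & hj) | (l & hnd & hl)].
    - exists j, 1; rewrite hj; split; [exact I | lia].
    - destruct (classic (exists j, In j l /\ j <> typ a /\ cval (mu (kt a) j) <> 0))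
        as [(j & _ & hj & hc) | hno].
      + exists j, 0; split; [destruct (mu (kt a) j); simpl in *; auto; lia | tauto].
      + exists (typ a), 1; split; [| lia].
        enough (h : forall l, NoDup l ->
          (forall j, In j l -> j <> typ a -> cval (mu (kt a) j) = 0) ->
          fold_right (fun j s => cval (mu (kt a) j) + s) 0 l <= cval (mu (kt a) (typ a)) /\
          (~ In (typ a) l -> fold_right (fun j s => cval (mu (kt a) j) + s) 0 l = 0)).
        { destruct (h l hnd) as [h' _].
          - intros j hj hj'; apply NNPP; intros hc; apply hno; eauto.
          - destruct (mu (kt a) (typ a)); simpl in *; lia. }
        clear; induction l as [| j l IH]; simpl; [intros; split; lia |].
        intros hnd hz; inversion hnd as [| ? ? hni hnd']; subst.
        destruct IH as [IH1 IH2]; auto.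
        destruct (classic (j = typ a)) as [-> | hj].
        * split; [rewrite IH2 by exact hni; lia | tauto].
        * rewrite (hz j) by auto; split; [exact IH1 | tauto]. }
  assert (hv : valid [(a, j, n)]) by (repeat split; auto; discriminate).
  set (u := exist _ _ hv : copy).
  assert (two : forall c : V0, exists b, b <> c).
  { intros c; destruct hbic as (_ & (b & b' & _ & h & _) & _).
    destruct (classic (b = c)) as [<- |]; eauto. }
  destruct (two a) as (b & hb), (two (rep j)) as (c & hc).
  assert (nu : place u c <> place base a).
  { intros e; apply (f_equal (@proj1_sig _ _)) in e; simpl in e.
    destruct excluded_middle_informative; [contradiction | discriminate]. }
  exists (place base a), (place u c), (place base b); split; [exact nu |]; split.
  - intros e; apply place_inj in e; contradiction.
  - apply (copies_separated base u a j n []); auto.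
    intros (q & e); apply (f_equal (@length _)) in e; simpl in e.
    rewrite length_app in e; simpl in e; lia.
Qed.

End Canonical.

(** * Unfolding a realization along the canonical tree *)

(** Words grow at the front, so the suffix [t] is the last common ancestor of two copies: they
    agree, one lies below the other, or they part at [t] by different letters. *)
Lemma common_suffix {T} (w u : list T) : exists t,
  (w = t /\ u = t) \/ (exists q l, w = q ++ l :: t /\ u = t) \/
  (exists q l, w = t /\ u = q ++ l :: t) \/
  (exists q1 l1 q2 l2, w = q1 ++ l1 :: t /\ u = q2 ++ l2 :: t /\ l1 <> l2).
Proof.
  revert u; induction w as [| x w IH] using rev_ind; intros u;
    destruct u as [| y u _] using rev_ind.
  - exists []; auto.
  - exists []; right; right; left; exists u, y; auto.
  - exists []; right; left; exists w, x; auto.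
  - destruct (classic (x = y)) as [<- | hne].
    + destruct (IH u) as (t & h); exists (t ++ [x]).
      destruct h as [[-> ->] | [(q & l & -> & ->) | [(q & l & -> & ->) |
        (q1 & l1 & q2 & l2 & -> & -> & h)]]].
      * auto.
      * right; left; exists q, l; rewrite <- app_assoc; auto.
      * right; right; left; exists q, l; rewrite <- app_assoc; auto.
      * right; right; right; exists q1, l1, q2, l2; rewrite <- !app_assoc; auto.
    + exists []; right; right; right; exists w, x, u, y; auto.
Qed.

Section Unfolding.
Context {V0 J K : Type} {adj0 : V0 -> V0 -> Prop} {mu : K -> J -> option nat}
  {typ : V0 -> J} {rep : J -> V0} {kt : V0 -> K} {H : (V0 -> V0) -> Prop}
  {Q : J -> V0 -> Prop}
  (hG0 : simple_graph adj0) (hbic : biconnected adj0) (hH : aut_subgroup adj0 H)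
  (hQ : forall j a, Q j a <-> typ a = j) (hrep : forall j, typ (rep j) = j)
  (horb : forall a b, typ a = typ b <-> exists h, H h /\ h a = b)
  (hmu : forall a, mu (kt a) (typ a) <> Some 0)
  (hkt : forall k a, mu k (typ a) <> Some 0 -> k = kt a)
  {V : Type} {adj : V -> V -> Prop} {sigma : (V * V -> Prop) -> V0 -> V}
  (hG : simple_graph adj) (hcount : countable_vtx V) (hconn : connected adj)
  (hsigma : forall L, is_lobe adj L -> lobe_iso adj0 L (sigma L))
  (htype : forall v, exists k, forall j,
    has_card (fun L => is_lobe adj L /\ exists a, Q j a /\ sigma L a = v) (mu k j)).

Definition lobes_at (v : V) (j : J) (L : V * V -> Prop) : Prop :=
  is_lobe adj L /\ exists a, Q j a /\ sigma L a = v.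

(** The enumeration at a vertex depends on the lobe [L] one arrives from, since [L] must receive
    number 0 within its own type, as the parent does in words. *)
Lemma lobe_enumeration : exists enum : (V * V -> Prop) -> V -> J -> nat -> V * V -> Prop,
  forall L a, is_lobe adj L -> forall j,
    enumerates (enum L (sigma L a) j) (lobes_at (sigma L a) j) (mu (kt a) j) /\
    (lobes_at (sigma L a) j L -> enum L (sigma L a) j 0 = L).
Proof.
  destruct (lobes_countable hG0 hbic hG hsigma hcount) as (code & hcode).
  destruct (functional_choice (fun (p : (V * V -> Prop) * V * J) g =>
    let '(L, v, j) := p in forall a, is_lobe adj L -> v = sigma L a ->
      enumerates g (lobes_at v j) (mu (kt a) j) /\ (lobes_at v j L -> g 0 = L)))
    as (enum & henum).
  { intros [[L v] j]; destruct (classic (is_lobe adj L)) as [hL |]; [| exists (fun _ => L); tauto].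
    destruct (htype v) as (k & hk).
    destruct (has_card_enumerates_from _ _ code L
      (fun x y hx hy => hcode x y (proj1 hx) (proj1 hy)) (hk j)) as (g & hg & hg0).
    exists g; intros a _ ->; replace (kt a) with k; [split; assumption |].
    (* [L] is itself counted at this vertex under [typ a], so [mu k (typ a)] is nonzero and [k] can
       only be [kt a]. *)
    apply hkt; intros e; specialize (hk (typ a)); rewrite e in hk.
    destruct hk as ([| ? ?] & _ & hlen & hin); [| discriminate].
    apply (proj1 (hin L)); split; [exact hL |]; exists a; split; [apply hQ |]; reflexivity. }
  exists (fun L v j => enum (L, v, j)); intros L a hL j.
  apply (henum (L, sigma L a, j)); auto.
Qed.

(** The root of a copy of type [j] is always [rep j], whereas [sigma L] may meet [v] at any member
    of that orbit; transitivity of [H] on the orbit provides the correction. The identity serves as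
    default, so that membership in [H] is unconditional. *)
Lemma lobe_turning : exists turn : (V * V -> Prop) -> V -> J -> V0 -> V0,
  forall L v j, H (turn L v j) /\ (lobes_at v j L -> sigma L (turn L v j (rep j)) = v).
Proof.
  destruct (functional_choice (fun (p : (V * V -> Prop) * V * J) h =>
    let '(L, v, j) := p in H h /\ (lobes_at v j L -> sigma L (h (rep j)) = v))) as (turn & ht).
  { intros [[L v] j].
    destruct (classic (lobes_at v j L)) as [(_ & a & ha & <-) | hn].
    - apply hQ in ha; rewrite <- ha in *.
      destruct (proj1 (horb (rep (typ a)) a)) as (h & hh & e); [apply hrep |].
      exists h; rewrite e; auto.
    - exists (fun x => x); split; [exact (proj1 (proj2 hH)) | contradiction]. }
  exists (fun L v j => turn (L, v, j)); intros L v j; apply (ht (L, v, j)).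
Qed.

(** * Lobes and vertices assigned to words *)

Section Enumerated.
Context (enum : (V * V -> Prop) -> V -> J -> nat -> V * V -> Prop)
  (henum : forall L a, is_lobe adj L -> forall j,
    enumerates (enum L (sigma L a) j) (lobes_at (sigma L a) j) (mu (kt a) j) /\
    (lobes_at (sigma L a) j L -> enum L (sigma L a) j 0 = L))
  (turn : (V * V -> Prop) -> V -> J -> V0 -> V0)
  (hturn : forall L v j, H (turn L v j) /\ (lobes_at v j L -> sigma L (turn L v j (rep j)) = v))
  (L0 : V * V -> Prop) (hL0 : is_lobe adj L0).

Fixpoint state (w : @word V0 J) : (V * V -> Prop) * (V0 -> V0) :=
  match w with
  | [] => (L0, fun x => x)
  | (a, j, n) :: w =>
      let v := sigma (fst (state w)) (snd (state w) a) in
      let L := enum (fst (state w)) v j n in (L, turn L v j)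
  end.

Definition lobe (w : word) : V * V -> Prop := fst (state w).
Definition pos (w : word) (a : V0) : V := sigma (lobe w) (snd (state w) a).

Lemma H_typ h a : H h -> typ (h a) = typ a.
Proof. intros hh; symmetry; apply horb; eauto. Qed.

Lemma kt_typ a b : typ a = typ b -> kt a = kt b.
Proof. intros e; apply hkt; rewrite <- e; apply hmu. Qed.

Lemma state_good w : valid mu typ rep kt w -> is_lobe adj (lobe w) /\ H (snd (state w)).
Proof.
  induction w as [| [[a j] n] w IH]; intros hw; [split; [exact hL0 | exact (proj1 (proj2 hH))] |].
  destruct hw as (hw & _ & hn & _); destruct (IH hw) as [hL hh]; split; [| apply hturn].
  destruct (henum (lobe w) (snd (state w) a) hL j) as [[_ hsur] _].
  apply (hsur (lobe ((a, j, n) :: w))); exists n; split; [| reflexivity].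
  (* Turning by [H] preserves types, hence also the row of [mu] that bounds the letters at [a]. *)
  replace (kt (snd (state w) a)) with (kt a); [exact hn |].
  apply kt_typ; symmetry; apply H_typ, hh.
Qed.

Lemma lobe_vtx_pos w a : valid mu typ rep kt w -> lobe_vtx (lobe w) (pos w a).
Proof. intros hw; apply hsigma, state_good, hw. Qed.

Lemma pos_inj w a b : valid mu typ rep kt w -> pos w a = pos w b -> a = b.
Proof.
  intros hw; destruct (state_good w hw) as [hL hh]; intros h.
  apply hsigma in h; [| exact hL]; apply hH in h; assumption.
Qed.

Lemma lobe_enumerates w a j : valid mu typ rep kt w ->
  enumerates (enum (lobe w) (pos w a) j) (lobes_at (pos w a) j) (mu (kt a) j) /\
  (j = typ a -> enum (lobe w) (pos w a) j 0 = lobe w).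
Proof.
  intros hw; destruct (state_good w hw) as [hL hh].
  destruct (henum (lobe w) (snd (state w) a) hL j) as [h1 h2].
  rewrite (kt_typ (snd (state w) a) a) in h1 by apply H_typ, hh; split; [exact h1 |].
  intros ->; apply h2; split; [exact hL |].
  exists (snd (state w) a); split; [apply hQ, H_typ, hh | reflexivity].
Qed.

Lemma lobe_child_at a j n w : valid mu typ rep kt ((a, j, n) :: w) ->
  lobes_at (pos w a) j (lobe ((a, j, n) :: w)).
Proof.
  intros (hw & _ & hn & _); destruct (lobe_enumerates w a j hw) as [[_ hsur] _].
  apply hsur; exists n; split; [exact hn | reflexivity].
Qed.

Lemma pos_root a j n w : valid mu typ rep kt ((a, j, n) :: w) ->
  pos ((a, j, n) :: w) (rep j) = pos w a.
Proof. intros hw; apply hturn, lobe_child_at, hw. Qed.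

Lemma lobe_vtx_child a j n w : valid mu typ rep kt ((a, j, n) :: w) ->
  lobe_vtx (lobe ((a, j, n) :: w)) (pos w a).
Proof. intros hw; rewrite <- (pos_root a j n w hw); apply lobe_vtx_pos, hw. Qed.

Lemma lobes_at_typ v j j' L : lobes_at v j L -> lobes_at v j' L -> j = j'.
Proof.
  intros (hL & b & hb & e) (_ & b' & hb' & e'); rewrite <- e' in e.
  apply hsigma in e; [| exact hL]; subst b'; apply hQ in hb, hb'; congruence.
Qed.

(** A lobe meets a vertex in one position only, so a child equal to its parent would have type
    [typ a]; injectivity of the enumeration would then give it number 0, the excluded letter. *)
Lemma lobe_child_neq a j n w : valid mu typ rep kt ((a, j, n) :: w) ->
  lobe ((a, j, n) :: w) <> lobe w.
Proof.
  intros hw e; pose proof (lobe_child_at a j n w hw) as hat; rewrite e in hat.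
  destruct hw as (hw & _ & hn & hne); destruct (state_good w hw) as [hL hh].
  assert (ej : j = typ a).
  { apply (lobes_at_typ _ _ _ _ hat); split; [exact hL |].
    exists (snd (state w) a); split; [apply hQ, H_typ, hh | reflexivity]. }
  apply hne; split; [exact ej |].
  destruct (lobe_enumerates w a j hw) as [[hinj _] h0].
  apply hinj; [exact hn | destruct (mu (kt a) j); simpl in *; auto; lia |].
  rewrite h0 by exact ej; exact e.
Qed.

Lemma lobe_siblings_neq a j n j' n' w : valid mu typ rep kt ((a, j, n) :: w) ->
  valid mu typ rep kt ((a, j', n') :: w) -> (a, j, n) <> (a, j', n') ->
  lobe ((a, j, n) :: w) <> lobe ((a, j', n') :: w).
Proof.
  intros hw hw' hne e; pose proof (lobe_child_at a j n w hw) as hat; rewrite e in hat.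
  pose proof (lobes_at_typ _ _ _ _ hat (lobe_child_at a j' n' w hw')) as ej; subst j'.
  destruct hw as (hw & _ & hn & _), hw' as (_ & _ & hn' & _).
  destruct (lobe_enumerates w a j hw) as [[hinj _] _].
  apply hne; f_equal; apply hinj; assumption.
Qed.

Lemma pos_normalize w a : valid mu typ rep kt w ->
  pos (fst (normalize rep w a)) (snd (normalize rep w a)) = pos w a.
Proof.
  intros hw; destruct w as [| [[b j] n] w]; [reflexivity |]; simpl normalize.
  destruct excluded_middle_informative as [-> | h]; [| reflexivity].
  symmetry; apply pos_root, hw.
Qed.

Lemma valid_suffix q t : valid mu typ rep kt (q ++ t) -> valid mu typ rep kt t.
Proof. induction q as [| [[a j] n] q IH]; [auto | intros h; apply IH, h]. Qed.

Definition in_root_branch (w : @word V0 J) (z : V) : Prop :=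
  match w with (a, _, _) :: t => branch adj (pos t a) (lobe w) z | [] => True end.

(** Branches nest along a word: validity keeps each branching off the root of its copy, which
    supplies [r <> v] in [branch_incl]. *)
Lemma in_root_branch_suffix q l t z : valid mu typ rep kt (q ++ l :: t) ->
  in_root_branch (q ++ l :: t) z -> in_root_branch (l :: t) z.
Proof.
  induction q as [| [[a j] n] q IH]; [auto |]; intros hw hz; apply IH; [apply hw |].
  simpl app in hw, hz; simpl in hz.
  destruct (q ++ l :: t) as [| [[b i] m] w] eqn:E; [exact I |].
  pose proof hw as (hw' & ha & _).
  apply (branch_incl hG0 hbic hG hsigma (lobe ((b, i, m) :: w))
    (lobe ((a, j, n) :: (b, i, m) :: w)) (pos w b) (pos ((b, i, m) :: w) a));
    try apply state_good; auto.
  - apply lobe_child_neq, hw.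
  - rewrite <- (pos_root b i m w hw'); intros e; apply pos_inj in e; [| exact hw'].
    apply ha; simpl; congruence.
  - apply lobe_vtx_child, hw'.
  - apply lobe_vtx_pos, hw'.
  - apply lobe_vtx_child, hw.
Qed.

Lemma pos_in_branch q a j n t b : normal mu typ rep kt (q ++ (a, j, n) :: t, b) ->
  branch adj (pos t a) (lobe ((a, j, n) :: t)) (pos (q ++ (a, j, n) :: t) b).
Proof.
  intros [hw hb]; simpl in hw, hb.
  apply (in_root_branch_suffix q (a, j, n) t); [exact hw |].
  destruct (q ++ (a, j, n) :: t) as [| [[c i] m] w]; [exact I |].
  apply branch_of_lobe_vtx; [apply lobe_vtx_pos, hw |].
  rewrite <- (pos_root c i m w hw); intros e; apply pos_inj in e; [| exact hw].
  apply hb; simpl; congruence.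
Qed.

(** Compare at the last common ancestor [t]. A vertex of [t] lies in no branch hanging off [t], and
    two different letters lead into disjoint branches, whether they are attached at the same vertex
    of [t] or at different ones. *)
Lemma pos_normal_inj x y : normal mu typ rep kt x -> normal mu typ rep kt y ->
  pos (fst x) (snd x) = pos (fst y) (snd y) -> x = y.
Proof.
  destruct x as [w a], y as [u b]; simpl; intros hx hy e.
  assert (apart : forall q l t c d, normal mu typ rep kt (q ++ l :: t, c) ->
    pos t d = pos (q ++ l :: t) c -> False).
  { clear w u a b hx hy e; intros q [[a j] n] t c d hx e.
    pose proof (valid_suffix _ _ (proj1 hx)) as hl; pose proof hl as (ht & _).
    apply (branch_disjoint_lobe hG0 hbic hG hsigma (lobe t) (lobe ((a, j, n) :: t))
      (pos t a) (pos t d)); try apply state_good; auto using lobe_vtx_pos.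
    - apply lobe_child_neq, hl.
    - apply lobe_vtx_child, hl.
    - rewrite e; apply pos_in_branch, hx. }
  destruct (common_suffix w u) as (t & [[-> ->] | [(q & l & -> & ->) | [(q & l & -> & ->) |
    (q1 & [[a1 j1] n1] & q2 & [[a2 j2] n2] & -> & -> & hne)]]]).
  - apply pos_inj in e; [congruence | apply hx].
  - destruct (apart q l t a b hx (eq_sym e)).
  - destruct (apart q l t b a hy e).
  - exfalso.
    pose proof (valid_suffix _ _ (proj1 hx)) as h1; pose proof (valid_suffix _ _ (proj1 hy)) as h2.
    pose proof h1 as (ht & _).
    apply pos_in_branch in hx, hy; rewrite <- e in hy.
    destruct (classic (a1 = a2)) as [<- | ha].
    + apply (branch_disjoint hG0 hbic hG hsigma _ _ _ _ (proj1 (state_good _ h1))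
        (proj1 (state_good _ h2)) (lobe_siblings_neq _ _ _ _ _ _ h1 h2 hne)
        (lobe_vtx_child _ _ _ _ h1) (lobe_vtx_child _ _ _ _ h2) hx hy).
    + apply (branch_disjoint_along hG0 hbic hG hsigma (lobe t) (lobe ((a1, j1, n1) :: t))
        (lobe ((a2, j2, n2) :: t)) (pos t a1) (pos t a2)
        (pos (q1 ++ (a1, j1, n1) :: t) a)); try apply state_good;
        auto using lobe_child_neq, lobe_vtx_child, lobe_vtx_pos.
      intros h; apply pos_inj in h; auto.
Qed.

Definition unfold_vertex (x : vertex mu typ rep kt) : V := pos (fst (proj1_sig x)) (snd (proj1_sig x)).

Lemma unfold_place w a : unfold_vertex (place mu typ rep kt w a) = pos (proj1_sig w) a.
Proof. apply pos_normalize, (proj2_sig w). Qed.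

Lemma unfold_inj x y : unfold_vertex x = unfold_vertex y -> x = y.
Proof.
  intros h; apply vertex_eq, pos_normal_inj; [exact (proj2_sig x) | exact (proj2_sig y) | exact h].
Qed.

Lemma unfold_adj x y : cadj adj0 mu typ rep kt x y -> adj (unfold_vertex x) (unfold_vertex y).
Proof.
  intros (w & a & b & hab & <- & <-); rewrite !unfold_place.
  destruct (state_good _ (proj2_sig w)) as [hL hh].
  apply (sigma_adj hsigma); [exact hL |]; apply hH; assumption.
Qed.

(** A lifting property as for coverings; with connectedness it gives surjectivity, and with
    injectivity it reflects adjacency. The lobe of the edge is enumerated at the image of [x], hence
    belongs to some copy, where undoing the turning locates both ends. *)
Lemma unfold_edge_lift x z : adj (unfold_vertex x) z ->
  exists y, cadj adj0 mu typ rep kt x y /\ unfold_vertex y = z.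
Proof.
  intros hz; destruct (lobe_of_edge _ _ _ hz) as (L & hL & hxz).
  enough (exists w : copy mu typ rep kt, lobe (proj1_sig w) = L) as (w & <-).
  { destruct (lobe_edge_preimage hG hsigma _ _ _ hL hxz) as (a & b & hab & ea & eb).
    destruct (state_good _ (proj2_sig w)) as [_ hh].
    destruct hH as (haut & _ & _ & hinv); destruct (hinv _ hh) as (g & hg & _ & hg').
    assert (hp : forall c, unfold_vertex (place mu typ rep kt w (g c)) =
      sigma (lobe (proj1_sig w)) c).
    { intros c; rewrite unfold_place; unfold pos; rewrite hg'; reflexivity. }
    exists (place mu typ rep kt w (g b)); split; [| rewrite hp; exact eb].
    exists w, (g a), (g b); split; [apply haut; assumption |]; split; [| reflexivity].
    apply unfold_inj; rewrite hp; exact ea. }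
  destruct x as [[w a] [hw ha]]; unfold unfold_vertex in hxz; simpl in *.
  destruct (hsigma L hL) as (_ & _ & h3 & _).
  destruct (h3 (pos w a)) as (c & hc); [exists z; exact hxz |].
  assert (hat : lobes_at (pos w a) (typ c) L).
  { split; [exact hL |]; exists c; split; [apply hQ; reflexivity | exact hc]. }
  destruct (lobe_enumerates w a (typ c) hw) as [[_ hsur] h0].
  destruct (proj1 (hsur L) hat) as (n & hn & e).
  (* Number 0 of type [typ a] is the copy [w] itself; every other index forms a valid letter. *)
  destruct (classic (typ c = typ a /\ n = 0)) as [[h1 ->] | hne].
  - exists (exist _ w hw); simpl; rewrite <- e; symmetry; apply h0, h1.
  - assert (hv : valid mu typ rep kt ((a, typ c, n) :: w)) by (simpl; tauto).
    exists (exist _ _ hv); exact e.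
Qed.

Lemma unfold_surj z : exists x, unfold_vertex x = z.
Proof.
  destruct hbic as (([o _] & _) & _), hconn as [_ hr].
  apply (reach_closed adj (fun z => exists x, unfold_vertex x = z)
    (unfold_vertex (place mu typ rep kt (base mu typ rep kt) o))).
  - intros s t (x & <-) hst; destruct (unfold_edge_lift x t hst) as (y & _ & hy); eauto.
  - eauto.
  - apply hr.
Qed.

Lemma unfold_adj_iff x y :
  cadj adj0 mu typ rep kt x y <-> adj (unfold_vertex x) (unfold_vertex y).
Proof.
  split; [apply unfold_adj |]; intros h.
  destruct (unfold_edge_lift x _ h) as (y' & hy' & e); apply unfold_inj in e; subst; exact hy'.
Qed.

End Enumerated.

Lemma unfolding L0 : is_lobe adj L0 ->
  exists f : vertex mu typ rep kt -> V,
    (forall x y, f x = f y -> x = y) /\ (forall y, exists x, f x = y) /\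
    (forall x y, cadj adj0 mu typ rep kt x y <-> adj (f x) (f y)) /\
    (forall a, f (place mu typ rep kt (base mu typ rep kt) a) = sigma L0 a).
Proof.
  intros hL0; destruct lobe_enumeration as (enum & henum), lobe_turning as (turn & hturn).
  exists (unfold_vertex enum turn L0); split; [| split; [| split]].
  - eapply unfold_inj; eassumption.
  - eapply unfold_surj; eassumption.
  - eapply unfold_adj_iff; eassumption.
  - reflexivity.
Qed.

End Unfolding.

(** * Existence, lobe-transitivity and uniqueness of the realization *)

Theorem theorem3p5
  (V0 : Type) (adj0 : V0 -> V0 -> Prop)
  (Hsimple : simple_graph adj0) (Hcount : countable_vtx V0)
  (Hbic : biconnected adj0)
  (H : (V0 -> V0) -> Prop) (HH : aut_subgroup adj0 H)
  (J : Type) (Q : J -> V0 -> Prop) (HQ : orbits_indexed H Q)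
  (K : Type) (R : K -> V0 -> Prop) (HR : partition_indexed R)
  (HQR : forall j, exists k, forall v, Q j v -> R k v)
  (mu : K -> J -> option nat)
  (Hmu : forall k j, mu k j <> Some 0 <-> (forall v, Q j v -> R k v))
  (Hsum : exists k, card_sum_ge2 (mu k)) :
  (exists (V : Type) (adj : V -> V -> Prop), realizes adj0 Q mu adj) /\
  (forall (V1 : Type) (adj1 : V1 -> V1 -> Prop) (V2 : Type) (adj2 : V2 -> V2 -> Prop),
      realizes adj0 Q mu adj1 -> realizes adj0 Q mu adj2 -> graph_iso adj1 adj2).
Proof.
  destruct HQ as (HQorb & HQcov & HQinj), HR as (HRne & HRcov & HRdisj).
  destruct (functional_choice _ HQcov) as (typ & htyp).
  destruct (functional_choice _ HRcov) as (kt & hkt0).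
  destruct (functional_choice _ HQorb) as (rep & horb0).
  pose proof HH as (_ & hid & hcomp & hinv).
  (* [Q j] comes as the orbit of one base point; inverses and products in [H] make it the orbit of
     each of its members. *)
  assert (horbit : forall j a b, Q j a -> (Q j b <-> exists h, H h /\ h a = b)).
  { intros j a b ha; apply horb0 in ha; destruct ha as (h & hh & <-); rewrite horb0.
    split; intros (g & hg & <-).
    - destruct (hinv h hh) as (h' & hh' & e & _); exists (fun x => g (h' x)).
      rewrite e; auto.
    - exists (fun x => g (h x)); auto. }
  assert (hQ : forall j a, Q j a <-> typ a = j).
  { intros j a; split; [| intros <-; apply htyp]; intros ha; apply HQinj; intros b.
    rewrite (horbit _ _ b (htyp a)), (horbit _ _ b ha); reflexivity. }
  assert (hrep : forall j, typ (rep j) = j).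
  { intros j; apply hQ, horb0; exists (fun x => x); auto. }
  assert (horb : forall a b, typ a = typ b <-> exists h, H h /\ h a = b).
  { intros a b; rewrite <- (horbit (typ a) a b (htyp a)), hQ; split; congruence. }
  assert (hmu : forall a, mu (kt a) (typ a) <> Some 0).
  { intros a; apply Hmu; destruct (HQR (typ a)) as (k & hk).
    replace (kt a) with k; [exact hk |]; apply (HRdisj _ _ a); auto. }
  assert (hkt : forall k a, mu k (typ a) <> Some 0 -> k = kt a).
  { intros k a h; apply (HRdisj _ _ a); auto; apply (proj1 (Hmu _ _) h), htyp. }
  pose proof (fun V adj sigma => @unfolding V0 J K adj0 mu typ rep kt H Q Hsimple Hbic HH
    hQ hrep horb hmu hkt V adj sigma) as unfolding.
  set (C := cadj adj0 mu typ rep kt).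
  set (o := base mu typ rep kt) in *.
  split.
  - exists (vertex mu typ rep kt), C.
    assert (hC : simple_graph C) by (apply cadj_simple, Hsimple).
    assert (hCc : countable_vtx (vertex mu typ rep kt)) by (apply vertex_countable; assumption).
    assert (hC1 : connectivity1 C).
    { destruct Hsum as (k & hk), (HRne k) as (a & ha).
      apply canonical_connectivity1 with k a; auto; apply (HRdisj _ _ a); auto. }
    set (sigma := fun L => place mu typ rep kt (pick_copy adj0 mu typ rep kt L)).
    assert (hsigma : forall L, is_lobe C L -> lobe_iso adj0 L (sigma L)).
    { intros L hL; apply canonical_lobe_iso; assumption. }
    assert (hcnt : forall v, exists k, forall j,
      has_card (fun L => is_lobe C L /\ exists a, Q j a /\ sigma L a = v) (mu k j)).
    { intros v; eexists; intros j; apply canonical_count; assumption. }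
    split; [exact hC | split; [exact hCc | split; [exact hC1 | split]]].
    + intros L1 L2 h1 h2.
      destruct (unfolding _ C sigma hC hCc (proj1 hC1) hsigma hcnt L1 h1)
        as (f1 & i1 & s1 & a1 & b1).
      destruct (unfolding _ C sigma hC hCc (proj1 hC1) hsigma hcnt L2 h2)
        as (f2 & i2 & s2 & a2 & b2).
      destruct (functional_choice _ s1) as (g & hg).
      assert (hgf : forall x, g (f1 x) = x) by auto.
      exists (fun x => f2 (g x)); split; [split; [| split] |].
      * intros x y h; apply i2 in h; rewrite <- (hg x), <- (hg y), h; reflexivity.
      * intros y; destruct (s2 y) as (x & <-); exists (f1 x); rewrite hgf; reflexivity.
      * intros x y; rewrite <- a2, <- (hg x), <- (hg y), <- a1, !hgf; reflexivity.
      (* Both unfoldings are prescribed on the base copy, so the composite carries [sigma L1] to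
         [sigma L2]. *)
      * assert (hs : forall a, f2 (g (sigma L1 a)) = sigma L2 a).
        { intros a; rewrite <- b1, hgf; apply b2. }
        intros [x y]; simpl; split; intros h.
        -- destruct (lobe_edge_preimage hC hsigma _ _ _ h1 h) as (a & b & hab & <- & <-).
           rewrite !hs; apply hsigma; assumption.
        -- destruct (lobe_edge_preimage hC hsigma _ _ _ h2 h) as (a & b & hab & ea & eb).
           rewrite <- hs in ea, eb; apply i2 in ea, eb.
           rewrite <- (hg x), <- (hg y), <- ea, <- eb, !hg; apply hsigma; assumption.
    + exists sigma; split; [exact hsigma | exact hcnt].
  - assert (key : forall V (adj : V -> V -> Prop), realizes adj0 Q mu adj ->
      exists f : vertex mu typ rep kt -> V, (forall x y, f x = f y -> x = y) /\
        (forall y, exists x, f x = y) /\ (forall x y, C x y <-> adj (f x) (f y))).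
    { intros V adj (hG & hc & (hconn & w & x & _ & hx & _) & _ & sigma & hsigma & hcnt).
      (* Connectivity 1 provides two distinct vertices, hence an edge and a lobe to start from. *)
      destruct (proj2 hconn x w) as [| x y z hxy _]; [congruence |].
      destruct (lobe_of_edge adj x y hxy) as (L & hL & _).
      destruct (unfolding V adj sigma hG hc hconn hsigma hcnt L hL) as (f & hf1 & hf2 & hf3 & _).
      exists f; auto. }
    intros V1 adj1 V2 adj2 h1 h2.
    destruct (key V1 adj1 h1) as (f1 & i1 & s1 & a1), (key V2 adj2 h2) as (f2 & i2 & s2 & a2).
    destruct (functional_choice _ s1) as (g & hg).
    assert (hgf : forall x, g (f1 x) = x) by auto.
    exists (fun x => f2 (g x)); split; [| split].
    + intros x y h; apply i2 in h; rewrite <- (hg x), <- (hg y), h; reflexivity.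
    + intros y; destruct (s2 y) as (x & <-); exists (f1 x); rewrite hgf; reflexivity.
    + intros x y; rewrite <- a2, <- (hg x), <- (hg y), <- a1, !hgf; reflexivity.
Qed.
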